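(* Suppose the weighted composition operators $C_{\phi_1,\omega_1}$ and $C_{\phi_2,\omega_2}$ in $L^2(\mu)$ are densely defined. Let $\mathbf{C}_{\phi,\omega}=\binom{U_1}{U_2}|\mathbf{C}_{\phi,\omega}|$ be the polar decomposition of the pair $\mathbf{C}_{\phi,\omega}=(C_{\phi_1,\omega_1},C_{\phi_2,\omega_2})$, and fix $\lambda\in(0,1)$. Then the following assertions are equivalent: (i) $\mathcal{M}_\lambda(\mathbf{C}_{\phi,\omega})=\mathbf{C}_{\phi,\omega}$; (ii) $U_i|\mathbf{C}_{\phi,\omega}|\subseteq|\mathbf{C}_{\phi,\omega}|U_i$ for $i=1,2$; (iii) $C_{\phi_i,\omega_i}|\mathbf{C}_{\phi,\omega}|^2\subseteq|\mathbf{C}_{\phi,\omega}|^2C_{\phi_i,\omega_i}$ for $i=1,2$; (iv) $C_{\phi_i,\omega_i}\big(C_{\phi_1,\omega_1}^*C_{\phi_1,\omega_1}+C_{\phi_2,\omega_2}^*C_{\phi_2,\omega_2}\big)\subseteq\big(C_{\phi_1,\omega_1}^*C_{\phi_1,\omega_1}+C_{\phi_2,\omega_2}^*C_{\phi_2,\omega_2}\big)C_{\phi_i,\omega_i}$ for $i=1,2$.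
   Context: $(X,\mathscr{A},\mu)$ is a $\sigma$-finite measure space and $L^2(\mu)$ is the complex Hilbert space. For an $\mathscr{A}$-measurable transformation $\phi:X\to X$ and an $\mathscr{A}$-measurable $\omega:X\to\mathbb{C}$, put $\mu_\omega(\Delta)=\int_\Delta|\omega|^2d\mu$. The weighted composition operator $C_{\phi,\omega}$ in $L^2(\mu)$ has domain $\{f\in L^2(\mu):\omega\cdot(f\circ\phi)\in L^2(\mu)\}$ and acts by $C_{\phi,\omega}f=\omega\cdot(f\circ\phi)$. It is always assumed that $\mu_\omega\circ\phi^{-1}\ll\mu$ (so $C_{\phi,\omega}$ is well-defined). A pair $(T_1,T_2)$ of operators in $L^2(\mu)$ is identified with the column operator $f\mapsto\binom{T_1f}{T_2f}$ from $L^2(\mu)$ into $L^2(\mu)\oplus L^2(\mu)$ with domain $\mathcal{D}(T_1)\cap\mathcal{D}(T_2)$; equality of pairs means equality of these operators (including domains). When both components are densely defined, $\mathbf{C}_{\phi,\omega}$ is densely defined and closed, so it has a polar decomposition $\mathbf{C}_{\phi,\omega}=\binom{U_1}{U_2}|\mathbf{C}_{\phi,\omega}|$ with $|\mathbf{C}_{\phi,\omega}|=(\mathbf{C}_{\phi,\omega}^*\mathbf{C}_{\phi,\omega})^{1/2}$. The $\lambda$-spherical mean transform is $$\mathcal{M}_\lambda(\mathbf{C}_{\phi,\omega})=\big(\lambda U_1|\mathbf{C}_{\phi,\omega}|+(1-\lambda)|\mathbf{C}_{\phi,\omega}|U_1,\ \lambda U_2|\mathbf{C}_{\phi,\omega}|+(1-\lambda)|\mathbf{C}_{\phi,\omega}|U_2\big).$$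 All sums and products of operators carry their natural domains, and $A\subseteq B$ means that $B$ extends $A$. *)

(* Defs.v *)
From HB Require Import structures.
From mathcomp Require Import all_boot all_order all_algebra.
From mathcomp Require Import generic_quotient ring_quotient.
From mathcomp Require Import complex ring.
From mathcomp Require Import all_classical all_reals all_analysis.
From mathcomp Require Import measurable_realfun.

Set Implicit Arguments.
Unset Strict Implicit.
Unset Printing Implicit Defensive.

Import Order.TTheory GRing.Theory Num.Theory.
Import numFieldNormedType.Exports.

Local Open Scope classical_set_scope.
Local Open Scope ring_scope.

(* An unbounded operator from H to K is identified with its graph, a subset of
   H * K.  Equality of operators (domains included) is then equality of sets,
   and "S is extended by T" is the inclusion S `<=` T.  Inner products are
   linear in the first argument. *)
Section operators.
Variable C : numClosedFieldType.

Section basic.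
Variables H K L : lmodType C.

Definition opdom (T : set (H * K)) : set H := [set f | exists g, T (f, g)].

Definition is_operator (T : set (H * K)) : Prop :=
  [/\ T 0,
      forall (a : C) p q, T p -> T q -> T (a *: p + q)
    & forall g, T (0, g) -> g = 0].

Definition graph_of (U : H -> K) : set (H * K) := [set p | p.2 = U p.1].

(* the product ST, with domain {f in D(T) | Tf in D(S)} *)
Definition opcomp (S : set (K * L)) (T : set (H * K)) : set (H * L) :=
  [set p | exists k, T (p.1, k) /\ S (k, p.2)].

Definition opadd (S T : set (H * K)) : set (H * K) :=
  [set p | exists g h, [/\ S (p.1, g), T (p.1, h) & p.2 = g + h]].

Definition opscale (a : C) (T : set (H * K)) : set (H * K) :=
  [set p | exists g, T (p.1, g) /\ p.2 = a *: g].

Definition opcolumn (S : set (H * K)) (T : set (H * L)) : set (H * (K * L)) :=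
  [set p | S (p.1, p.2.1) /\ T (p.1, p.2.2)].

End basic.

Definition dotD (K L : lmodType C) (ipK : K -> K -> C) (ipL : L -> L -> C)
    (p q : K * L) : C :=
  ipK p.1 q.1 + ipL p.2 q.2.

Section hilbert.
Variables (H K : lmodType C) (ipH : H -> H -> C) (ipK : K -> K -> C).

Definition densely_defined (T : set (H * K)) : Prop :=
  forall (f : H) (e : C), 0 < e ->
    exists2 g, opdom T g & sqrtC (ipH (f - g) (f - g)) < e.

(* (g, h) is in the graph of T^* iff <Tf, g> = <f, h> for all f in D(T);
   this relation is single-valued when T is densely defined. *)
Definition adjoint (T : set (H * K)) : set (K * H) :=
  [set q | forall p, T p -> ipK p.2 q.1 = ipH p.1 q.2].

(* U is bounded, everywhere defined, and isometric on the orthogonal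
   complement of its kernel. *)
Definition partial_isometry (U : H -> K) : Prop :=
  [/\ linear U,
      exists M : C,
        forall f, sqrtC (ipK (U f) (U f)) <= M * sqrtC (ipH f f)
    & forall f, (forall g, U g = 0 -> ipH f g = 0) ->
        sqrtC (ipK (U f) (U f)) = sqrtC (ipH f f)].

End hilbert.

Section polar.
Variables (H K : lmodType C) (ipH : H -> H -> C) (ipK : K -> K -> C).

Definition positive_selfadjoint (P : set (H * H)) : Prop :=
  [/\ is_operator P, densely_defined ipH P, adjoint ipH ipH P = P
    & forall p, P p -> 0 <= ipH p.2 p.1].

(* P = (T^* T)^{1/2}: P is the (unique) positive selfadjoint square root
   of T^* T. *)
Definition is_modulus (T : set (H * K)) (P : set (H * H)) : Prop :=
  positive_selfadjoint P /\ opcomp P P = opcomp (adjoint ipH ipK T) T.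

(* T = U |T| with U a partial isometry such that ker U = ker T. *)
Definition is_polar_decomposition (T : set (H * K)) (U : H -> K)
    (P : set (H * H)) : Prop :=
  [/\ is_modulus T P,
      partial_isometry ipH ipK U,
      forall f, U f = 0 <-> T (f, 0)
    & T = opcomp (graph_of U) P].

End polar.
End operators.

Section L2_space.
Context d (X : measurableType d) (R : realType).
Variable mu : {measure set X -> \bar R}.

Definition cmeasurable (f : X -> R[i]) : Prop :=
  measurable_fun setT (fun x => complex.Re (f x)) /\
  measurable_fun setT (fun x => complex.Im (f x)).

Definition sqnormc (z : R[i]) : R := complex.Re z ^+ 2 + complex.Im z ^+ 2.

Lemma sqnormcE (z : R[i]) : (sqnormc z)%:C%C = `|z| ^+ 2.
Proof. exact: add_Re2_Im2. Qed.

Definition square_integrable (f : X -> R[i]) : Prop :=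
  (\int[mu]_x (sqnormc (f x))%:E < +oo)%E.

Definition L2pred : {pred X -> R[i]} :=
  mem [set f | cmeasurable f /\ square_integrable f].

Lemma sqnormc_ge0 z : 0 <= sqnormc z.
Proof. by rewrite addr_ge0 ?sqr_ge0. Qed.

Lemma sqnormcM a z : sqnormc (a * z) = sqnormc a * sqnormc z.
Proof. by case: a z => [a b] [x y]; rewrite /sqnormc /=; ring. Qed.

Lemma sqnormcB z t : sqnormc (z - t) <= 2 * sqnormc z + 2 * sqnormc t.
Proof.
case: z t => [a b] [x y]; rewrite /sqnormc /= -subr_ge0.
rewrite (_ : _ - _ = (a + x) ^+ 2 + (b + y) ^+ 2); last by ring.
by rewrite addr_ge0 ?sqr_ge0.
Qed.

Lemma cmeasurableB f g : cmeasurable f -> cmeasurable g -> cmeasurable (f - g).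
Proof.
have ReB (z t : R[i]) : complex.Re (z - t) = complex.Re z - complex.Re t.
  by case: z t => [? ?] [].
have ImB (z t : R[i]) : complex.Im (z - t) = complex.Im z - complex.Im t.
  by case: z t => [? ?] [].
move=> [mfr mfi] [mgr mgi]; split.
- rewrite (_ : (fun x => _) =
    (fun x => complex.Re (f x) - complex.Re (g x))); first exact: measurable_funB.
  by apply/funext => x; exact: ReB.
- rewrite (_ : (fun x => _) =
    (fun x => complex.Im (f x) - complex.Im (g x))); first exact: measurable_funB.
  by apply/funext => x; exact: ImB.
Qed.

Lemma cmeasurableZ a f : cmeasurable f -> cmeasurable (fun x => a * f x).
Proof.
case: a => a b [mr mi]; split => /=.
- have -> : (fun x => complex.Re ((a +i* b)%C * f x)) =
      (fun x => a * complex.Re (f x) - b * complex.Im (f x)).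
    by apply/funext => x; case: (f x).
  by apply: measurable_funB; apply: measurable_funM.
- have -> : (fun x => complex.Im ((a +i* b)%C * f x)) =
      (fun x => a * complex.Im (f x) + b * complex.Re (f x)).
    by apply/funext => x; case: (f x).
  by apply: measurable_funD; apply: measurable_funM.
Qed.

Lemma measurable_sqnormc f :
  cmeasurable f -> measurable_fun setT (fun x => (sqnormc (f x))%:E).
Proof.
move=> [mr mi]; apply/measurable_EFinP.
by apply: measurable_funD; apply: measurable_funX.
Qed.

Lemma L2predP f : reflect (cmeasurable f /\ square_integrable f) (f \in L2pred).
Proof. by apply: (iffP idP); rewrite inE. Qed.

Lemma L2pred_zmod_closed : zmod_closed L2pred.
Proof.
split.
  apply/L2predP; split; first by split; exact: measurable_cst.
  rewrite /square_integrable.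
  under eq_integral do rewrite /sqnormc /= expr0n addr0.
  by rewrite integral0.
move=> f g /L2predP[mf If] /L2predP[mg Ig]; apply/L2predP; split.
  exact: cmeasurableB.
pose h x : \bar R := (2%:E * (sqnormc (f x))%:E + 2%:E * (sqnormc (g x))%:E)%E.
have m2 k : cmeasurable k ->
    measurable_fun setT (fun x => 2%:E * (sqnormc (k x))%:E : \bar R)%E.
  by move=> mk; apply: emeasurable_funM => //; exact: measurable_sqnormc.
apply: (@le_lt_trans _ _ (\int[mu]_x h x)%E).
  apply: ge0_le_integral => //.
  - by move=> x _; rewrite lee_fin sqnormc_ge0.
  - exact/measurable_sqnormc/cmeasurableB.
  - by apply: emeasurable_funD; apply: m2.
  - by move=> x _; rewrite /h -!EFinM -EFinD lee_fin; exact: sqnormcB.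
rewrite /h ge0_integralD //; last 4 first.
- by move=> x _; rewrite mule_ge0 // lee_fin sqnormc_ge0.
- exact: m2.
- by move=> x _; rewrite mule_ge0 // lee_fin sqnormc_ge0.
- exact: m2.
rewrite !ge0_integralZl //; try exact: measurable_sqnormc;
  try by move=> x _; rewrite lee_fin sqnormc_ge0.
by rewrite lte_add_pinfty // lte_mul_pinfty.
Qed.

HB.instance Definition _ :=
  GRing.isZmodClosed.Build (X -> R[i]) L2pred L2pred_zmod_closed.

Lemma L2pred_scale a f : f \in L2pred -> (fun x => a * f x) \in L2pred.
Proof.
move=> /L2predP[mf If]; apply/L2predP; split; first exact: cmeasurableZ.
rewrite /square_integrable.
under eq_integral do rewrite sqnormcM EFinM.
rewrite ge0_integralZl ?lee_fin ?sqnormc_ge0 //.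
- by rewrite lte_mul_pinfty // lee_fin sqnormc_ge0.
- exact: measurable_sqnormc.
- by move=> x _; rewrite lee_fin sqnormc_ge0.
Qed.

Record L2fun := MkL2fun { L2val :> X -> R[i]; _ : L2val \in L2pred }.

HB.instance Definition _ := [isSub for L2val].
HB.instance Definition _ := [Choice of L2fun by <:].
HB.instance Definition _ := [SubChoice_isSubZmodule of L2fun by <:].

Definition L2null : {pred L2fun} := mem [set f : L2fun | f = cst 0 %[ae mu]].

Lemma L2nullP (f : L2fun) : reflect (f = cst 0 %[ae mu]) (f \in L2null).
Proof. by apply: (iffP idP); rewrite inE. Qed.

Lemma L2null_zmod_closed : zmod_closed L2null.
Proof.
split; first by apply/L2nullP/aeW.
move=> f g /L2nullP f0 /L2nullP g0; apply/L2nullP.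
apply: filterS2 f0 g0 => x f0 g0 _.
have fx : L2val f x = 0 := f0 I; have gx : L2val g x = 0 := g0 I.
have E : L2val (f - g) x = L2val f x - L2val g x by [].
by rewrite E fx gx subrr.
Qed.

HB.instance Definition _ := GRing.isZmodClosed.Build L2fun L2null L2null_zmod_closed.

(* complex L^2(mu): square integrable functions modulo null functions *)
Definition L2 : Type := Quotient.quot L2null.

HB.instance Definition _ := GRing.Zmodule.on L2.

Definition L2class (f : L2fun) : L2 := \pi_(Quotient.quot L2null)%qT f.

Definition L2repr (F : L2) : L2fun := repr (F : Quotient.quot L2null).

Lemma L2reprK F : L2class (L2repr F) = F.
Proof. exact: reprK. Qed.

Lemma L2classP f g : L2class f = L2class g <-> L2val f = L2val g %[ae mu].
Proof.
have E : (L2class f == L2class g) = (f - g \in L2null).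
  by rewrite (Quotient.idealrBE L2null f g).
split.
  move=> /eqP; rewrite E => /L2nullP; apply: filterS => x /(_ I) fg _.
  exact/eqP/(etrans (esym (subr_eq0 _ _)))/eqP.
move=> fg; apply/eqP; rewrite E; apply/L2nullP.
apply: filterS fg => x /(_ I) fg _.
have Ex : L2val (f - g) x = L2val f x - L2val g x by [].
by rewrite Ex fg subrr.
Qed.

Lemma L2classD f g : L2class (f + g) = L2class f + L2class g.
Proof. exact: raddfD. Qed.

Definition L2fun_scale (a : R[i]) (f : L2fun) : L2fun :=
  MkL2fun (L2pred_scale a (valP f)).

Definition L2scale (a : R[i]) (F : L2) : L2 := L2class (L2fun_scale a (L2repr F)).

Lemma L2scale_class a f : L2scale a (L2class f) = L2class (L2fun_scale a f).
Proof.
apply/L2classP.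
have /L2classP := L2reprK (L2class f).
by apply: filterS => x /(_ I) e _; rewrite /= e.
Qed.

Lemma L2scaleA a b F : L2scale a (L2scale b F) = L2scale (a * b) F.
Proof.
rewrite -[F]L2reprK !L2scale_class; congr L2class.
by apply/val_inj/funext => x /=; rewrite mulrA.
Qed.

Lemma L2scale1 F : L2scale 1 F = F.
Proof.
rewrite -[F]L2reprK !L2scale_class; congr L2class.
by apply/val_inj/funext => x /=; rewrite mul1r.
Qed.

Lemma L2scaleDr a : {morph L2scale a : F G / F + G}.
Proof.
move=> F G; rewrite -[F]L2reprK -[G]L2reprK -L2classD !L2scale_class -L2classD.
by congr L2class; apply/val_inj/funext => x; rewrite /= mulrDr.
Qed.

Lemma L2scaleDl F : {morph L2scale^~ F : a b / a + b}.
Proof.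
move=> a b; rewrite -[F]L2reprK !L2scale_class -L2classD.
by congr L2class; apply/val_inj/funext => x; rewrite /= mulrDl.
Qed.

HB.instance Definition _ := GRing.Zmodule_isLmodule.Build R[i] L2
  L2scaleA L2scale1 L2scaleDr L2scaleDl.

Definition cintegral (f : X -> R[i]) : R[i] :=
  (\int[mu]_x complex.Re (f x) +i* \int[mu]_x complex.Im (f x))%C.

Definition L2dot (F G : L2) : R[i] :=
  cintegral (fun x => L2repr F x * (L2repr G x)^*).

End L2_space.
Arguments L2dot {d X R} mu F G.

Section weighted_composition.
Context d (X : measurableType d) (R : realType).
Variable mu : {measure set X -> \bar R}.

Definition weighted_measure (w : X -> R[i]) (D : set X) : \bar R :=
  \int[mu]_(x in D) (sqnormc (w x))%:E.

(* C_{phi,w}; its domain is {f | w (f o phi) in L^2(mu)}.  When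
   mu_w o phi^-1 << mu the class of w (f o phi) does not depend on the chosen
   representative of f. *)
Definition wco (phi : X -> X) (w : X -> R[i]) : set (L2 mu * L2 mu) :=
  [set p | L2val (L2repr p.2) = (fun x => w x * L2repr p.1 (phi x)) %[ae mu]].

End weighted_composition.
Arguments wco {d X R} mu phi w.

(* the i-th component of the lambda-spherical mean transform of
   T = (U1, U2) |T|, where P = |T| *)
Definition mean_component (R : realType) (H : lmodType R[i]) (lambda : R)
    (U : H -> H) (P : set (H * H)) : set (H * H) :=
  opadd (opscale lambda%:C%C (opcomp (graph_of U) P))
        (opscale (1 - lambda)%:C%C (opcomp P (graph_of U))).

(* Main.v *)
Require Import Defs.
From HB Require Import structures.
From mathcomp Require Import all_boot all_order all_algebra.
From mathcomp Require Import complex ring lra.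
From mathcomp Require Import all_classical all_reals all_analysis.
From mathcomp Require Import measurable_realfun.

Set Implicit Arguments.
Unset Strict Implicit.
Unset Printing Implicit Defensive.

Import Order.TTheory GRing.Theory Num.Theory.
Import numFieldNormedType.Exports.

Local Open Scope classical_set_scope.
Local Open Scope ring_scope.

(** Everything reduces to one multiplication operator and to a pointwise
    condition.

    Since the operators are densely defined, the image under [phi_i] of the
    measure with density [|w_i|^2] has a finite valued density [h_i] with
    respect to [mu] ([wco_density]).  The quadratic form of the i-th operator
    [C_i] is therefore the integral of [h_i |f|^2], which makes [C_i^* C_i]
    multiplication by [h_i].  In the same way both [C^* C], for the column
    [C] of the two operators, and the sum of the [C_i^* C_i] are
    multiplication by [h = h_1 + h_2] ([adjoint_comp_mulop], [opadd_mulop]).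
    So [A = P ^ 2], and (iii) and (iv) are the same assertion.

    The modulus [P] is only given as a positive selfadjoint square root of
    multiplication by [h]; it has to be identified with multiplication by
    [sqrt h], at least on functions supported in some [h <= n]
    ([modulus_bounded]).  This is the uniqueness of positive square roots: [P]
    commutes with the resolvent [1 / (1 + h)] of its square, hence with
    polynomials in it, hence, being closed, with [sqrt h / (1 + h)], which is
    a pointwise limit of such polynomials; and two commuting positive square
    roots coincide.

    With these descriptions, each of (ii) and (iii) is equivalent to
    [h o phi_i = h] almost everywhere on [w_i <> 0] ([weight_invariant]).
    Testing either commutation relation on indicators of sets on which [h] is
    bounded gives the pointwise condition.  Conversely the condition gives
    (iii) by inspection, and gives (ii) on functions supported in
    [1/n <= h <= n], where [U_i] is explicit because [C = U P]; boundedness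
    of [U_i] and closedness of [P] extend it to the domain of [P].

    Finally (i) and (ii) are equivalent by linear algebra: on the domain of
    [P] both say that [P U_i f = U_i P f], because [lambda <> 1]. *)

(** * Graphs of linear operators *)

Section operator_graphs.
Variables (C : numClosedFieldType) (H K : lmodType C) (T : set (H * K)).
Hypothesis Top : is_operator T.

Lemma operatorB f f' g g' : T (f, f') -> T (g, g') -> T (f - g, f' - g').
Proof.
case: Top => _ lin _ Tf Tg; have := lin (-1) _ _ Tg Tf.
rewrite (_ : _ + _ = (f - g, f' - g')) //.
by congr pair; rewrite /= scaleN1r addrC.
Qed.

Lemma operator_inj f g g' : T (f, g) -> T (f, g') -> g = g'.
Proof.
move=> Tg Tg'; have := operatorB Tg Tg'; rewrite subrr => Td.
by case: Top => _ _ /(_ _ Td)/eqP; rewrite subr_eq0 => /eqP.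
Qed.

End operator_graphs.

(** * Image measures with a density *)

Section image_density.
Context d (X : measurableType d) (R : realType).
Variable mu : {measure set X -> \bar R}.
Variables (phi : X -> X) (v k : X -> R).
Hypotheses (mphi : measurable_fun setT phi).
Hypotheses (mv : measurable_fun setT v) (mk : measurable_fun setT k).
Hypotheses (v0 : forall x, 0 <= v x) (k0 : forall x, 0 <= k x).
Hypothesis vk : forall A, measurable A ->
  (\int[mu]_(x in phi @^-1` A) (v x)%:E = \int[mu]_(x in A) (k x)%:E)%E.

Import HBNNSimple.

Let simple_image_density (s : {nnsfun X >-> R}) :
  (\int[mu]_x (v x * s (phi x))%:E = \int[mu]_x (k x * s x)%:E)%E.
Proof.
have expand (u : X -> R) (t : X -> X) : measurable_fun setT u ->
    measurable_fun setT t -> (forall x, 0 <= u x) ->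
    (\int[mu]_x (u x * s (t x))%:E = \sum_(r \in range s)
      (r%:E * \int[mu]_(x in t @^-1` (s @^-1` [set r])) (u x)%:E))%E.
  move=> mu' mt u0.
  have r0 r : range s r -> 0 <= r by move=> -[x _ <-].
  have mB r : measurable (t @^-1` (s @^-1` [set r])).
    by rewrite -[X in measurable X]setTI; apply: mt => //.
  transitivity (\int[mu]_x (\sum_(r \in range s)
      (u x * (r * \1_(s @^-1` [set r]) (t x)))%:E))%E.
    apply: eq_integral => x _.
    rewrite fsumEFin // (fimfunE s (t x)) !fsbig_finite //=.
    by rewrite mulr_sumr.
  rewrite ge0_integral_fsum //; last 2 first.
  - move=> r; apply/measurable_EFinP/measurable_funM => //.
    apply/measurable_funM => //.
    by apply: (measurableT_comp (f := (\1_(s @^-1` [set r]) : X -> R))) => //; exact: measurable_indic.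
  - move=> r x _; rewrite lee_fin mulr_ge0 // indicE.
    case: (boolP (t x \in _)) => [|_]; last by rewrite mulr0.
    by rewrite inE /= => <-; rewrite mulr1.
  apply: eq_fsbigr => r /set_mem /r0 rge0.
  rewrite [X in (_ * X)%E]integral_mkcond -ge0_integralZl //.
  - apply: eq_integral => x _; rewrite patchE indicE.
    have -> : (x \in t @^-1` (s @^-1` [set r])) = (t x \in s @^-1` [set r]).
      by apply/idP/idP; rewrite !inE.
    case: ifPn => _; rewrite -?EFinM ?mulr1 ?mulr0 ?mule0 //.
    by rewrite mulrC.
  - by apply/(measurable_restrictT _ _).1 => //; apply/measurable_funTS/measurable_EFinP.
  - by move=> x _; rewrite patchE; case: ifP => // _; rewrite lee_fin.
rewrite (expand v phi) // (expand k id) //.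
by apply: eq_fsbigr => r _; rewrite vk.
Qed.

(** Monotone class argument: the identity passes from sets to simple functions
    by linearity, and from these to nonnegative functions by monotone
    convergence. *)
Lemma integral_image_density (g : X -> \bar R) : measurable_fun setT g ->
  (forall x, 0 <= g x)%E ->
  (\int[mu]_x ((v x)%:E * g (phi x)) = \int[mu]_x ((k x)%:E * g x))%E.
Proof.
move=> mg g0; pose s := nnsfun_approx measurableT mg.
have lim_expand (u : X -> R) (t : X -> X) : measurable_fun setT u ->
    measurable_fun setT t -> (forall x, 0 <= u x) ->
    (\int[mu]_x ((u x)%:E * g (t x)) =
     limn (fun n => \int[mu]_x (u x * s n (t x))%:E))%E.
  move=> mu' mt u0.
  rewrite -(@monotone_convergence _ _ _ mu setT measurableT) //.
  - apply: eq_integral => x _; apply/esym/cvg_lim => //.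
    under eq_fun do rewrite EFinM.
    apply: cvgeZl => //.
    by apply: (cvg_nnsfun_approx measurableT mg) => //= y _.
  - by move=> n; apply/measurable_EFinP/measurable_funM => //; exact: measurableT_comp.
  - by move=> n x _; rewrite lee_fin mulr_ge0.
  - move=> x _ a b ab; rewrite lee_fin ler_wpM2l //.
    by apply/lefP/nd_nnsfun_approx.
rewrite (lim_expand v phi) // (lim_expand k id) //.
by apply/congr_lim/funext => n; exact: simple_image_density.
Qed.

End image_density.

(** The image under [phi] of the measure with density [v] is a finite measure,
    absolutely continuous by the last hypothesis, so it has a Radon-Nikodym
    derivative [k]. *)
Lemma image_density_exists d (X : measurableType d) (R : realType)
    (mu : {sigma_finite_measure set X -> \bar R}) (phi : X -> X) (v : X -> R) :
  measurable_fun setT phi -> measurable_fun setT v -> (forall x, 0 <= v x) ->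
  (\int[mu]_x (v x)%:E < +oo)%E ->
  (forall A, measurable A -> mu A = 0%E ->
     (\int[mu]_(x in phi @^-1` A) (v x)%:E = 0)%E) ->
  exists k : X -> R, [/\ measurable_fun setT k, forall x, 0 <= k x &
    forall A, measurable A ->
      (\int[mu]_(x in phi @^-1` A) (v x)%:E = \int[mu]_(x in A) (k x)%:E)%E].
Proof.
move=> mphi mv v0 vfin vac.
pose nu (A : set X) : \bar R := (\int[mu]_(x in phi @^-1` A) (v x)%:E)%E.
have mpre A : measurable A -> measurable (phi @^-1` A).
  by move=> mA; rewrite -[X in measurable X]setTI; apply: mphi.
have mvE : measurable_fun setT (EFin \o v) by exact/measurable_EFinP.
have nu0 : nu set0 = 0%E by rewrite /nu preimage_set0 integral_set0.
have nu_ge0 A : (0 <= nu A)%E by apply: integral_ge0 => x _; rewrite lee_fin.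
have nu_sigma : semi_sigma_additive nu.
  move=> F mF tF mUF; rewrite /nu preimage_bigcup.
  apply: (@semi_sigma_additive_nng_induced _ _ _ mu (EFin \o v)) => //.
  - by move=> n; apply: mpre.
  - apply/trivIsetP => /= i j _ _ ij; rewrite -preimage_setI.
    by move/trivIsetP : tF => /(_ _ _ _ _ ij) ->//; rewrite preimage_set0.
  - by rewrite -preimage_bigcup; exact: mpre.
pose mnu : {measure set X -> \bar R} :=
  HB.pack nu (isMeasure.Build _ _ _ nu nu0 nu_ge0 nu_sigma).
have nufin : fin_num_fun mnu.
  move=> A mA; rewrite ge0_fin_numE ?nu_ge0 //.
  apply: le_lt_trans vfin; apply: ge0_subset_integral => //; first exact: mpre.
  by move=> x _; rewrite lee_fin.
pose fnu : {finite_measure set X -> \bar R} :=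
  HB.pack (Measure.sort mnu) (Measure_isFinite.Build _ _ _ mnu nufin).
have [|f [f0 ffin fint fE]] := @radon_nikodym_sigma_finite _ _ _ mu fnu.
  by apply/null_content_dominatesP => A mA; exact: vac.
have mf := measurable_int _ fint.
exists (fine \o f); split.
- exact: measurableT_comp.
- by move=> x; rewrite /= fine_ge0.
- move=> A mA; rewrite -[LHS]/(fnu A) fE //.
  by apply: eq_integral => x _; rewrite /= fineK.
Qed.

(** * Square integrable complex functions and their classes *)

Section complex_functions.
Context d (X : measurableType d) (R : realType).
Implicit Types (z t : R[i]) (f g : X -> R[i]) (a : X -> R).

Lemma Re_mulJ z t : complex.Re (z * t^*) =
  complex.Re z * complex.Re t + complex.Im z * complex.Im t.
Proof. by case: z t => [a b] [x y] /=; ring. Qed.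

Lemma Im_mulJ z t : complex.Im (z * t^*) =
  complex.Im z * complex.Re t - complex.Re z * complex.Im t.
Proof. by case: z t => [a b] [x y] /=; ring. Qed.

Lemma Re_realM (a : R) z : complex.Re (a%:C%C * z) = a * complex.Re z.
Proof. by case: z => [x y] /=; ring. Qed.

Lemma Im_realM (a : R) z : complex.Im (a%:C%C * z) = a * complex.Im z.
Proof. by case: z => [x y] /=; ring. Qed.

Lemma Re_sub z t : complex.Re (z - t) = complex.Re z - complex.Re t.
Proof. by case: z t => [? ?] []. Qed.

Lemma Im_sub z t : complex.Im (z - t) = complex.Im z - complex.Im t.
Proof. by case: z t => [? ?] []. Qed.

Lemma sqnormc_real (a : R) : sqnormc a%:C%C = a ^+ 2.
Proof. by rewrite /sqnormc /= expr0n addr0. Qed.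

Lemma sqnormc_eq0 z : sqnormc z = 0 -> z = 0.
Proof.
case: z => x y /eqP; rewrite /sqnormc /= paddr_eq0 ?sqr_ge0 // !sqrf_eq0.
by move=> /andP[/eqP -> /eqP ->].
Qed.

(** This bound and the next one make products of square integrable functions
    integrable. *)
Lemma normr_Re_mulJ z t : `|complex.Re (z * t^*)| <= sqnormc z + sqnormc t.
Proof.
rewrite Re_mulJ /sqnormc; case: z t => [a b] [x y] /=.
have := (sqr_ge0 (a + x), sqr_ge0 (a - x), sqr_ge0 (b + y), sqr_ge0 (b - y)).
rewrite ler_norml => -[[[h1 h2] h3] h4]; apply/andP; split; lra.
Qed.

Lemma normr_Im_mulJ z t : `|complex.Im (z * t^*)| <= sqnormc z + sqnormc t.
Proof.
rewrite Im_mulJ /sqnormc; case: z t => [a b] [x y] /=.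
have := (sqr_ge0 (b + x), sqr_ge0 (b - x), sqr_ge0 (a + y), sqr_ge0 (a - y)).
rewrite ler_norml => -[[[h1 h2] h3] h4]; apply/andP; split; lra.
Qed.

Lemma cmeasurableM f g : cmeasurable f -> cmeasurable g ->
  cmeasurable (fun x => f x * g x).
Proof.
move=> [fr fi] [gr gi]; split.
- rewrite (_ : (fun x => _) = (fun x => complex.Re (f x) * complex.Re (g x) -
      complex.Im (f x) * complex.Im (g x))).
    by apply: measurable_funB; apply: measurable_funM.
  by apply/funext => x; case: (f x) (g x) => [? ?] [].
- rewrite (_ : (fun x => _) = (fun x => complex.Re (f x) * complex.Im (g x) +
      complex.Im (f x) * complex.Re (g x))).
    by apply: measurable_funD; apply: measurable_funM.
  by apply/funext => x; case: (f x) (g x) => [? ?] [].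
Qed.

Lemma cmeasurable_conj f : cmeasurable f -> cmeasurable (fun x => (f x)^*).
Proof.
move=> [fr fi]; split.
- rewrite (_ : (fun x => _) = (fun x => complex.Re (f x))) //.
  by rewrite funeqE => x; case: (f x).
- rewrite (_ : (fun x => _) = (fun x => - complex.Im (f x))).
    exact: measurableT_comp.
  by rewrite funeqE => x; case: (f x).
Qed.

Lemma cmeasurable_real a : measurable_fun setT a ->
  cmeasurable (fun x => (a x)%:C%C).
Proof. by move=> ma; split => //=; exact: measurable_cst. Qed.

Lemma cmeasurable_realM a f : measurable_fun setT a -> cmeasurable f ->
  cmeasurable (fun x => (a x)%:C%C * f x).
Proof. by move=> ma mf; apply: cmeasurableM => //; exact: cmeasurable_real. Qed.

Lemma cmeasurable_comp f (phi : X -> X) : measurable_fun setT phi ->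
  cmeasurable f -> cmeasurable (fun x => f (phi x)).
Proof.
move=> mphi [mr mi]; split.
- exact: (measurableT_comp mr mphi).
- exact: (measurableT_comp mi mphi).
Qed.

Lemma measurable_inv_ge0 a : measurable_fun setT a -> (forall x, 0 <= a x) ->
  measurable_fun setT (fun x => (a x)^-1).
Proof.
move=> ma a0; rewrite (_ : (fun x => _) = (fun x => a x `^ (-1))).
  exact: (measurableT_comp (measurable_powR (-1))).
by apply/funext => x; rewrite powR_inv1.
Qed.

Lemma measurable_sqrt_ge0 a : measurable_fun setT a -> (forall x, 0 <= a x) ->
  measurable_fun setT (fun x => Num.sqrt (a x)).
Proof.
move=> ma a0; rewrite (_ : (fun x => _) = (fun x => a x `^ (2^-1))).
  exact: (measurableT_comp (measurable_powR (2^-1))).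
by apply/funext => x; rewrite powR12_sqrt.
Qed.

End complex_functions.

Section L2_theory.
Context d (X : measurableType d) (R : realType).
Variable mu : {measure set X -> \bar R}.
Implicit Types (F G H : L2 mu) (f g : X -> R[i]) (a : X -> R).

(** The chosen representative of a class is only known almost everywhere.
    Working with every function equal to it almost everywhere frees the
    computations from that choice. *)
Definition represents F f : Prop := L2val (L2repr F) = f %[ae mu].

Lemma represents_repr F : represents F (L2repr F).
Proof. exact: aeW. Qed.

Lemma cmeasurable_repr F : cmeasurable (L2repr F).
Proof. by case: (L2repr F) => f /= /L2predP[]. Qed.

Lemma square_integrable_repr F : square_integrable mu (L2repr F).
Proof. by case: (L2repr F) => f /= /L2predP[]. Qed.

Lemma represents_inj F G f : represents F f -> represents G f -> F = G.
Proof.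
move=> Ff Gf; rewrite -(L2reprK F) -(L2reprK G); apply/L2classP.
by apply: filterS2 Ff Gf => x e1 e2 /[dup] /e1 -> /e2 ->.
Qed.

Lemma represents_ae F f g : represents F f -> f = g %[ae mu] -> represents F g.
Proof. by move=> Ff fg; apply: filterS2 Ff fg => x e1 e2 /[dup] /e1 -> /e2 ->. Qed.

Lemma represents_ext F f g : represents F f -> f =1 g -> represents F g.
Proof. by move=> Ff fg; apply: represents_ae Ff _; apply: aeW => x _; exact: fg. Qed.

Lemma represents_class (f : L2fun mu) : represents (L2class f) f.
Proof. by apply/(L2classP _ f); rewrite L2reprK. Qed.

Lemma represents_exists f : cmeasurable f -> square_integrable mu f ->
  exists F, represents F f.
Proof.
move=> mf If; have /L2predP Hf := conj mf If.
by exists (L2class (MkL2fun Hf)); exact: represents_class.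
Qed.

Lemma represents_square_integrable F f : cmeasurable f -> represents F f ->
  square_integrable mu f.
Proof.
move=> mf Ff; rewrite /square_integrable.
rewrite -(ge0_ae_eq_integral (f := fun x => (sqnormc (L2repr F x))%:E)) //.
- exact: square_integrable_repr.
- exact/measurable_sqnormc/cmeasurable_repr.
- exact: measurable_sqnormc.
- by move=> x _; rewrite lee_fin sqnormc_ge0.
- by move=> x _; rewrite lee_fin sqnormc_ge0.
- by apply: filterS Ff => x e _; rewrite e.
Qed.

Lemma represents0 : represents 0 (cst 0).
Proof.
have <- : L2class (0 : L2fun mu) = 0 by exact: raddf0.
by apply: represents_ext (represents_class _) _.
Qed.

Lemma representsD F G f g : represents F f -> represents G g ->
  represents (F + G) (fun x => f x + g x).
Proof.
move=> Ff Gg; rewrite -{1}(L2reprK F) -{1}(L2reprK G) -L2classD.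
apply: represents_ae (represents_class _) _.
by apply: filterS2 Ff Gg => x e1 e2 _ /=; rewrite -e1 // -e2.
Qed.

Lemma representsZ c F f : represents F f ->
  represents (c *: F) (fun x => c * f x).
Proof.
move=> Ff; apply: represents_ae (represents_class _) _.
by apply: filterS Ff => x e _ /=; rewrite -e.
Qed.

Lemma representsB F G f g : represents F f -> represents G g ->
  represents (F - G) (fun x => f x - g x).
Proof.
move=> Ff Gg; rewrite -scaleN1r.
apply: represents_ext (representsD Ff (representsZ (-1) Gg)) _ => x /=.
by rewrite mulN1r.
Qed.

Lemma represents_mul_exists F a (M : R) : measurable_fun setT a ->
  (forall x, `|a x| <= M) ->
  exists G, represents G (fun x => (a x)%:C%C * L2repr F x).
Proof.
move=> ma aM; apply: represents_exists.
  exact/cmeasurable_realM/cmeasurable_repr.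
have M0 (x : X) : 0 <= M := le_trans (normr_ge0 _) (aM x).
apply: (@le_lt_trans _ _ (\int[mu]_x ((M ^+ 2)%:E * (sqnormc (L2repr F x))%:E))%E).
  apply: ge0_le_integral => //.
  - by move=> x _; rewrite lee_fin sqnormc_ge0.
  - exact/measurable_sqnormc/cmeasurable_realM/cmeasurable_repr.
  - apply/measurable_EFinP/measurable_funM => //.
    exact/measurable_EFinP/measurable_sqnormc/cmeasurable_repr.
  - move=> x _; rewrite -EFinM lee_fin sqnormcM sqnormc_real.
    apply: ler_wpM2r; first exact: sqnormc_ge0.
    by rewrite -real_normK ?num_real // lerXn2r ?nnegrE //; exact: M0 x.
rewrite ge0_integralZl //.
- rewrite lte_mul_pinfty ?lee_fin ?sqr_ge0 //; exact: square_integrable_repr.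
- exact/measurable_sqnormc/cmeasurable_repr.
- by move=> x _; rewrite lee_fin sqnormc_ge0.
- by rewrite lee_fin sqr_ge0.
Qed.

Lemma integrable_dominated (u : X -> R) F G : measurable_fun setT u ->
  (forall x, `|u x| <= sqnormc (L2repr F x) + sqnormc (L2repr G x)) ->
  mu.-integrable setT (EFin \o u).
Proof.
move=> mu' uFG.
have msq (K : L2 mu) : measurable_fun setT (fun x => (sqnormc (L2repr K x))%:E).
  exact/measurable_sqnormc/cmeasurable_repr.
apply: (@le_integrable _ _ _ mu setT measurableT _
  (fun x => (sqnormc (L2repr F x))%:E + (sqnormc (L2repr G x))%:E)%E).
- exact/measurable_EFinP.
- move=> x _; rewrite -EFinD !abse_EFin lee_fin.
  by rewrite [leRHS]ger0_norm // addr_ge0 ?sqnormc_ge0.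
- apply: integrableD => //; apply/integrableP; split => //.
  + under eq_integral do rewrite abse_EFin ger0_norm ?sqnormc_ge0 //.
    exact: square_integrable_repr.
  + under eq_integral do rewrite abse_EFin ger0_norm ?sqnormc_ge0 //.
    exact: square_integrable_repr.
Qed.

Lemma cmeasurable_dot F G :
  cmeasurable (fun x => L2repr F x * (L2repr G x)^*).
Proof.
by apply: cmeasurableM; [|apply: cmeasurable_conj]; exact: cmeasurable_repr.
Qed.

Lemma integrable_Re_dot F G :
  mu.-integrable setT (fun x => (complex.Re (L2repr F x * (L2repr G x)^*))%:E).
Proof.
apply: (@integrable_dominated _ F G); first exact: (cmeasurable_dot F G).1.
by move=> x; exact: normr_Re_mulJ.
Qed.

Lemma integrable_Im_dot F G :
  mu.-integrable setT (fun x => (complex.Im (L2repr F x * (L2repr G x)^*))%:E).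
Proof.
apply: (@integrable_dominated _ F G); first exact: (cmeasurable_dot F G).2.
by move=> x; exact: normr_Im_mulJ.
Qed.

Lemma cintegral_ae f g : cmeasurable f -> cmeasurable g ->
  f = g %[ae mu] -> cintegral mu f = cintegral mu g.
Proof.
move=> [fr fi] [gr gi] fg; rewrite /cintegral; congr (_ +i* _)%C.
- congr fine; apply: ae_eq_integral => //; try exact/measurable_EFinP.
  by apply: filterS fg => x e _; rewrite e.
- congr fine; apply: ae_eq_integral => //; try exact/measurable_EFinP.
  by apply: filterS fg => x e _; rewrite e.
Qed.

Lemma L2dotE F G f g : cmeasurable f -> cmeasurable g ->
  represents F f -> represents G g ->
  L2dot mu F G = cintegral mu (fun x => f x * (g x)^*).
Proof.
move=> mf mg Ff Gg; apply: cintegral_ae.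
- exact: cmeasurable_dot.
- by apply: cmeasurableM => //; exact: cmeasurable_conj.
- by apply: filterS2 Ff Gg => x e1 e2 _; rewrite e1 // e2.
Qed.

Lemma L2dotBr F G H : L2dot mu F (G - H) = L2dot mu F G - L2dot mu F H.
Proof.
have eB : represents (G - H) (fun x => L2repr G x - L2repr H x).
  by apply: representsB; exact: represents_repr.
rewrite (L2dotE (cmeasurable_repr F) _ (represents_repr F) eB); last first.
  by apply: cmeasurableB; exact: cmeasurable_repr.
rewrite /L2dot /cintegral /GRing.add /GRing.opp /=.
apply/eqP; rewrite eq_complex /=; apply/andP; split; apply/eqP.
- rewrite -RintegralB //; try exact: integrable_Re_dot.
  by apply: eq_Rintegral => x _; rewrite -Re_sub -mulrBr -rmorphB.
- rewrite -RintegralB //; try exact: integrable_Im_dot.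
  by apply: eq_Rintegral => x _; rewrite -Im_sub -mulrBr -rmorphB.
Qed.

Lemma L2dot0l G : L2dot mu 0 G = 0.
Proof.
rewrite (L2dotE _ (cmeasurable_repr G) represents0 (represents_repr G)).
  rewrite /cintegral.
  under eq_Rintegral do rewrite mul0r /=.
  under [X in (_ +i* X)%C]eq_Rintegral do rewrite mul0r /=.
  by rewrite /Rintegral integral0.
by split; exact: measurable_cst.
Qed.

Definition L2sq F : \bar R := (\int[mu]_x (sqnormc (L2repr F x))%:E)%E.

Lemma L2sq_ge0 F : (0 <= L2sq F)%E.
Proof. by apply: integral_ge0 => x _; rewrite lee_fin sqnormc_ge0. Qed.

Lemma L2sq_fin F : L2sq F \is a fin_num.
Proof. by rewrite ge0_fin_numE ?L2sq_ge0 //; exact: square_integrable_repr. Qed.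

Lemma fine_L2sq_ge0 F : 0 <= fine (L2sq F).
Proof. by rewrite fine_ge0 ?L2sq_ge0. Qed.

Lemma L2sqE F f : cmeasurable f -> represents F f ->
  L2sq F = (\int[mu]_x (sqnormc (f x))%:E)%E.
Proof.
move=> mf Ff; apply: ge0_ae_eq_integral => //.
- exact/measurable_sqnormc/cmeasurable_repr.
- exact/measurable_sqnormc.
- by move=> x _; rewrite lee_fin sqnormc_ge0.
- by move=> x _; rewrite lee_fin sqnormc_ge0.
- by apply: filterS Ff => x e _; rewrite e.
Qed.

Lemma L2dot_sq F : L2dot mu F F = (fine (L2sq F))%:C%C.
Proof.
rewrite /L2dot /cintegral; congr (_ +i* _)%C.
  by apply: eq_Rintegral => x _; rewrite Re_mulJ /sqnormc !expr2.
under eq_Rintegral do rewrite Im_mulJ mulrC subrr.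
by rewrite /Rintegral integral0.
Qed.

Lemma integral_ge0_eq0 (u : X -> R) : measurable_fun setT u ->
  (forall x, 0 <= u x) -> (\int[mu]_x (u x)%:E = 0)%E ->
  {ae mu, forall x, u x = 0}.
Proof.
move=> mu' u0 int0.
have /(ae_eq_integral_abs mu measurableT)[+ _] : measurable_fun setT (EFin \o u).
  exact/measurable_EFinP.
under eq_integral do rewrite abse_EFin ger0_norm //.
by move=> /(_ int0); apply: filterS => x /(_ I) [].
Qed.

Lemma L2sq_eq0 F : L2sq F = 0%E -> F = 0.
Proof.
move=> F0; apply: represents_inj (represents_repr F) _.
apply: represents_ae represents0 _.
have : {ae mu, forall x, sqnormc (L2repr F x) = 0}.
  apply: integral_ge0_eq0 => //.
    exact/measurable_EFinP/measurable_sqnormc/cmeasurable_repr.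
  by move=> x; exact: sqnormc_ge0.
by apply: filterS => x e _; rewrite (sqnormc_eq0 e).
Qed.

Lemma L2dot_eq0 F : L2dot mu F F = 0 -> F = 0.
Proof.
rewrite L2dot_sq => -[F0]; apply: L2sq_eq0.
by rewrite -(fineK (L2sq_fin F)) F0.
Qed.

End L2_theory.

(** * The density attached to a weighted composition operator *)

Section approximation.
Context d (X : measurableType d) (R : realType).
Variable mu : {measure set X -> \bar R}.

Lemma ltr_sqrtC (x e : R) : 0 <= x -> 0 < e ->
  sqrtC (x%:C%C : R[i]) < e%:C%C -> x < e ^+ 2.
Proof.
move=> x0 e0; rewrite -ltcR.
have xC0 : (0 : R[i]) <= x%:C%C by rewrite lecR.
have eC0 : (0 : R[i]) <= e%:C%C by rewrite lecR ltW.
move=> h; rewrite -(sqrtCK x%:C%C) rmorphXn /=.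
by rewrite ltrXn2r ?sqrtC_ge0.
Qed.

Lemma densely_defined_approx (K : lmodType R[i]) (T : set (L2 mu * K))
    (F : L2 mu) (e : R) :
  densely_defined (L2dot mu) T -> 0 < e ->
  exists2 G, opdom T G & (L2sq (F - G)%R < (e ^+ 2)%:E)%E.
Proof.
move=> dT e0; have [|G TG FG] := dT F e%:C%C; first by rewrite ltcR.
exists G => //; rewrite -(fineK (L2sq_fin _)) lte_fin.
apply: ltr_sqrtC => //; last by rewrite -L2dot_sq.
exact: fine_L2sq_ge0.
Qed.

End approximation.

Section dense_support.
Context d (X : measurableType d) (R : realType).
Variable mu : {sigma_finite_measure set X -> \bar R}.

(** If the indicators of an exhausting sequence of sets of finite measure are
    approximated ever better by functions of the domain, then the part of any
    of these sets on which all the approximants vanish has measure at most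
    the squared error of every later approximant. *)
Lemma dense_support (K : lmodType R[i]) (T : set (L2 mu * K)) :
  densely_defined (L2dot mu) T ->
  exists f : nat -> L2 mu, (forall j, opdom T (f j)) /\
    mu [set x | forall j, L2repr (f j) x = 0] = 0%E.
Proof.
move=> dT; have /sigma_finiteP[A [AT Aincr /all_and2[mA Afin]]] :=
  sigma_finiteT mu.
pose one j x : R[i] := (\1_(A j) x)%:C%C.
have mone j : cmeasurable (one j).
  by apply: cmeasurable_real; exact: measurable_indic.
have sqone j x : sqnormc (one j x) = \1_(A j) x.
  by rewrite /one sqnormc_real indicE; case: (x \in A j); rewrite ?expr1n ?expr0n.
have /choice[E EP] j : exists F : L2 mu, represents F (one j).
  apply: represents_exists => //; rewrite /square_integrable.
  under eq_integral do rewrite sqone.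
  rewrite integral_indic // setIT; exact: Afin.
have /choice[f fP] j : exists F, opdom T F /\
    (L2sq (E j - F)%R < ((j.+1%:R^-1) ^+ 2)%:E)%E.
  by have [F] := @densely_defined_approx _ _ _ mu K T (E j) j.+1%:R^-1 dT
    (ltac:(by rewrite invr_gt0)); exists F.
exists f; split => [j|]; first exact: (fP j).1.
set N := [set x | _].
have mN : measurable N.
  rewrite (_ : N = \bigcap_j [set x | L2repr (f j) x = 0]).
    apply: bigcap_measurable => // j _.
    have [mr mi] := cmeasurable_repr (f j).
    rewrite (_ : [set x | _] =
      (fun x => complex.Re (L2repr (f j) x)) @^-1` [set 0] `&`
      (fun x => complex.Im (L2repr (f j) x)) @^-1` [set 0]).
      by apply: measurableI; rewrite -[X in measurable X]setTI;
        [apply: mr|apply: mi].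
    apply/seteqP; split => x /=; first by move=> ->.
    by case: (L2repr (f j) x) => [a b] /= [-> ->].
  by apply/seteqP; split => x /=; [move=> h j _; exact: h|move=> h j; exact: h].
have NA n : mu (N `&` A n) = 0%E.
  have bound j : (n <= j)%N -> (mu (N `&` A n) <= ((j.+1%:R^-1) ^+ 2)%:E)%E.
    move=> nj; apply: le_trans (ltW (fP j).2).
    rewrite (L2sqE (f := fun x => one j x - L2repr (f j) x)); last 2 first.
    - by apply: cmeasurableB => //; exact: cmeasurable_repr.
    - by apply: representsB => //; exact: represents_repr.
    rewrite -[X in mu X]setIT -integral_indic //; last exact: measurableI.
    apply: ge0_le_integral => //.
    - by apply/measurable_EFinP/measurable_indic/measurableI.
    - by apply: measurable_sqnormc; apply: cmeasurableB => //; exact: cmeasurable_repr.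
    - move=> x _; rewrite lee_fin indicE; case: (boolP (_ \in _)).
        rewrite inE => -[Nx Ax]; rewrite Nx subr0 sqone indicE mem_set //.
        by have /subsetPset := Aincr _ _ nj; exact.
      by move=> _; exact: sqnormc_ge0.
  apply/eqP; rewrite eq_le measure_ge0 andbT.
  apply/lee_addgt0Pr => e e0; rewrite add0e.
  have [m _ /(_ m (leqnn m)) /= me] := near_infty_natSinv_lt (PosNum e0).
  apply: le_trans (bound (maxn n m) (leq_maxl _ _)) _.
  rewrite lee_fin (le_trans _ (ltW me)) // expr2.
  have h : (maxn n m).+1%:R^-1 <= m.+1%:R^-1 :> R.
    by rewrite lef_pV2 ?posrE // ler_nat ltnS leq_maxr.
  apply: le_trans h; rewrite ler_piMr ?invr_ge0 // invf_le1 ?ler1n //.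
apply/negligibleP => //.
have -> : N = \bigcup_n (N `&` A n) by rewrite -setI_bigcupr -AT setIT.
apply: negligible_bigcup => n; apply/negligibleP; first exact: measurableI.
exact: NA.
Qed.

End dense_support.

Section weighted_composition_operator.
Context d (X : measurableType d) (R : realType).
Variable mu : {sigma_finite_measure set X -> \bar R}.
Variables (phi : X -> X) (w : X -> R[i]).
Hypotheses (mphi : measurable_fun setT phi) (mw : cmeasurable w).
Hypothesis ac : pushforward (weighted_measure mu w) phi `<< mu.

Let mpre A : measurable A -> measurable (phi @^-1` A).
Proof. by move=> mA; rewrite -[X in measurable X]setTI; apply: mphi. Qed.

(** Absolute continuity pointwise: [phi] sends the points where [w] does not
    vanish outside any given null set. *)
Lemma weight_ae0 A : measurable A -> mu A = 0%E ->
  {ae mu, forall x, A (phi x) -> w x = 0}.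
Proof.
move=> mA A0; have wA0 := (null_content_dominatesP _ _).1 ac A mA A0.
have /(ae_eq_integral_abs mu (mpre mA))[+ _] :
    measurable_fun (phi @^-1` A) (fun x => (sqnormc (w x))%:E).
  exact/measurable_funTS/measurable_sqnormc.
under eq_integral do rewrite abse_EFin ger0_norm ?sqnormc_ge0 //.
by move=> /(_ wA0); apply: filterS => x + Ax => /(_ Ax) [/sqnormc_eq0].
Qed.

Lemma weight_comp_ae (f g : X -> R[i]) : f = g %[ae mu] ->
  (fun x => w x * f (phi x)) = (fun x => w x * g (phi x)) %[ae mu].
Proof.
move=> [N [mN N0 fgN]]; apply: filterS (weight_ae0 mN N0) => x wN _.
have [Nx|nNx] := pselect (N (phi x)); first by rewrite wN // !mul0r.
congr (_ * _); apply: contrapT => nfg; apply: nNx; apply: fgN => /=.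
by move=> /(_ I).
Qed.

Lemma wcoE (F G : L2 mu) f : represents F f ->
  wco mu phi w (F, G) <-> represents G (fun x => w x * f (phi x)).
Proof.
move=> Ff; split => h.
  by apply: represents_ae (weight_comp_ae Ff).
by apply: represents_ae h _; apply: ae_eq_sym; exact: weight_comp_ae.
Qed.

Hypothesis dd : densely_defined (L2dot mu) (wco mu phi w).

(** A summable combination of squared moduli of functions of the domain is an
    almost everywhere positive weight that makes the image measure finite. *)
Lemma finite_weight : exists rho : X -> R,
  [/\ measurable_fun setT rho, forall x, 0 <= rho x <= 1,
      mu [set x | rho x = 0] = 0%E &
      (\int[mu]_x (sqnormc (w x) * rho (phi x))%:E < +oo)%E].
Proof.
have [f [fdom f0]] := dense_support dd.
have /choice[g fg] := fdom.
(* the j-th term then has integral at most [2 ^ - (j + 1)] against the image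
   measure *)
pose c j : R := (2 ^ j.+1)%:R^-1 / (1 + fine (L2sq (g j))).
have Ig0 j : 0 <= fine (L2sq (g j)) by exact: fine_L2sq_ge0.
have c0 j : 0 < c j.
  by rewrite divr_gt0 ?invr_gt0 ?ltr0n ?expn_gt0 // ltr_pwDl.
pose t j x : \bar R := (c j * sqnormc (L2repr (f j) x))%:E.
have t0 j x : (0 <= t j x)%E by rewrite lee_fin mulr_ge0 ?sqnormc_ge0 // ltW.
have mt j : measurable_fun setT (t j).
  apply/measurable_EFinP/measurable_funM => //.
  exact/measurable_EFinP/measurable_sqnormc/cmeasurable_repr.
pose S x := (\sum_(0 <= j <oo) t j x)%E.
have S0 x : (0 <= S x)%E by apply: nneseries_ge0.
have mS : measurable_fun setT S by apply: ge0_emeasurable_sum.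
have S_eq0 j x : S x = 0%E -> L2repr (f j) x = 0.
  move=> Sx0; have : (t j x <= 0)%E.
    rewrite -Sx0 /S; have := @nneseries_lim_ge _ (t ^~ x) xpredT 0%N j.+1.
    move=> /(_ (fun _ _ _ => t0 _ _)); apply: le_trans.
    by rewrite big_nat_recr //= leeDr // sume_ge0.
  rewrite lee_fin pmulr_rle0 // => h2; apply: sqnormc_eq0.
  by apply/eqP; rewrite eq_le h2 sqnormc_ge0.
(* the truncation at [1] keeps the weight finite *)
pose rho x := fine (mine 1%:E (S x)).
have minfin x : mine 1%:E (S x) \is a fin_num.
  rewrite ge0_fin_numE ?le_min ?lee_fin ?ler01 ?S0 //.
  by apply: (@le_lt_trans _ _ 1%:E); rewrite ?ge_min ?lexx // ltry.
have rhoE x : (rho x)%:E = mine 1%:E (S x) by rewrite /rho fineK.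
have mrho : measurable_fun setT rho.
  by apply: measurableT_comp => //; apply: measurable_mine.
have rho01 x : 0 <= rho x <= 1.
  by rewrite -!lee_fin rhoE le_min ge_min lexx S0 lee_fin ler01.
exists rho; split => //.
  have mrho0 : measurable [set x | rho x = 0].
    by rewrite -[X in measurable X]setTI; exact: (mrho measurableT [set 0]).
  apply/eqP; rewrite eq_le measure_ge0 andbT -f0.
  apply: le_measure; rewrite ?inE //.
    rewrite (_ : [set x | _] = S @^-1` [set 0%E]).
      by rewrite -[X in measurable X]setTI; apply: (mS measurableT [set 0%E]); exact: emeasurable_set1.
    apply/seteqP; split => x /= h.
      by rewrite /S eseries0 // => j _ _; rewrite /t h /sqnormc /= expr0n addr0 mulr0.
    by move=> j; exact: S_eq0.
  move=> x /= rx0 j.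
  have Sx0 : S x = 0%E.
    have := rhoE x; rewrite rx0 /mine; case: ifP => // _ [] /eqP.
    by rewrite eq_sym oner_eq0.
  exact: S_eq0.
have mwf j : cmeasurable (fun x => w x * L2repr (f j) (phi x)).
  by apply: cmeasurableM => //; apply: cmeasurable_comp => //; exact: cmeasurable_repr.
have term j : (\int[mu]_x ((sqnormc (w x))%:E * t j (phi x)) =
    (c j)%:E * L2sq (g j))%E.
  have := (wcoE (g j) (represents_repr (f j))).1 (fg j).
  move=> /(L2sqE (mwf j)) ->; rewrite -ge0_integralZl //.
  - by apply: eq_integral => x _; rewrite /t -!EFinM sqnormcM mulrCA.
  - exact: measurable_sqnormc.
  - by move=> x _; rewrite lee_fin sqnormc_ge0.
  - by rewrite lee_fin ltW.
apply: (@le_lt_trans _ _ 1%:E); last exact: ltry.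
apply: (@le_trans _ _
  (\int[mu]_x \sum_(0 <= j <oo) ((sqnormc (w x))%:E * t j (phi x)))%E).
  apply: ge0_le_integral => //.
  - by move=> x _; rewrite lee_fin mulr_ge0 ?sqnormc_ge0 //; case/andP: (rho01 (phi x)).
  - apply/measurable_EFinP/measurable_funM.
      exact/measurable_EFinP/measurable_sqnormc.
    exact: (measurableT_comp mrho mphi).
  - apply: ge0_emeasurable_sum => [j x _ _|j _].
      by rewrite mule_ge0 // lee_fin sqnormc_ge0.
    apply: emeasurable_funM; first exact: measurable_sqnormc.
    exact: (measurableT_comp (mt j) mphi).
  - move=> x _; rewrite nneseriesZl // EFinM rhoE; apply: lee_wpmul2l.
      by rewrite lee_fin sqnormc_ge0.
    by rewrite ge_min lexx orbT.
rewrite integral_nneseries //; last 2 first.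
- move=> j; apply: emeasurable_funM; first exact: measurable_sqnormc.
  exact: (measurableT_comp (mt j) mphi).
- by move=> j x _; rewrite mule_ge0 // lee_fin sqnormc_ge0.
apply: le_trans (epsilon_trick0 xpredT ler01).
apply: lee_nneseries => [j _ _|j _].
  by apply: integral_ge0 => x _; rewrite mule_ge0 // lee_fin sqnormc_ge0.
rewrite term -(fineK (L2sq_fin (g j))) -EFinM lee_fin /c div1r -mulrA.
rewrite ler_piMr ?invr_ge0 // mulrC ler_pdivrMr ?mul1r ?lerDr //.
by rewrite ltr_pwDl.
Qed.

(** The image of the measure [|w| ^ 2 mu] need not be finite.  Weighting it by
    [rho] makes it so, and dividing the derivative by [rho] undoes this, as
    [rho] vanishes only on a null set. *)
Theorem wco_density : exists h : X -> R,
  [/\ measurable_fun setT h, forall x, 0 <= h x &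
    forall g : X -> \bar R, measurable_fun setT g -> (forall x, 0 <= g x)%E ->
    (\int[mu]_x ((sqnormc (w x))%:E * g (phi x)) =
     \int[mu]_x ((h x)%:E * g x))%E].
Proof.
have [rho [mrho rho01 rho_pos vfin]] := finite_weight.
have rho0 x : 0 <= rho x by case/andP: (rho01 x).
pose v x := sqnormc (w x) * rho (phi x).
have msw : measurable_fun setT (fun x => sqnormc (w x)).
  exact/measurable_EFinP/measurable_sqnormc.
have mv : measurable_fun setT v.
  by apply: measurable_funM => //; exact: (measurableT_comp mrho mphi).
have v0 x : 0 <= v x by rewrite mulr_ge0 ?sqnormc_ge0.
have vac A : measurable A -> mu A = 0%E ->
    (\int[mu]_(x in phi @^-1` A) (v x)%:E = 0)%E.
  move=> mA A0; rewrite (ae_eq_integral (cst 0%E)) ?integral0 //.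
  - exact: mpre.
  - exact/measurable_funTS/measurable_EFinP.
  - apply: filterS (weight_ae0 mA A0) => x + Ax => /(_ Ax) wx0.
    by rewrite /v wx0 /sqnormc /= expr0n addr0 mul0r.
have [k [mk k0 vk]] := image_density_exists mphi mv v0 vfin vac.
exists (fun x => k x * (rho x)^-1); split.
- by apply: measurable_funM => //; exact: measurable_inv_ge0.
- by move=> x; rewrite mulr_ge0 ?invr_ge0.
move=> g mg g0.
pose g' x := (((rho x)^-1)%:E * g x)%E.
have mg' : measurable_fun setT g'.
  apply: emeasurable_funM => //.
  by apply/measurable_EFinP; exact: measurable_inv_ge0.
have g'0 x : (0 <= g' x)%E by rewrite mule_ge0 // lee_fin invr_ge0.
rewrite [RHS](_ : _ = \int[mu]_x ((k x)%:E * g' x))%E; last first.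
  by apply: eq_integral => x _; rewrite EFinM muleA.
rewrite -(integral_image_density mphi mv mk v0 k0 vk mg' g'0).
have mrho0 : measurable [set x | rho x = 0].
  by rewrite -[X in measurable X]setTI; exact: (mrho measurableT [set 0]).
apply: ge0_ae_eq_integral => //.
- apply: emeasurable_funM; first exact/measurable_EFinP.
  exact: (measurableT_comp mg mphi).
- apply: emeasurable_funM; first exact/measurable_EFinP.
  exact: (measurableT_comp mg' mphi).
- by move=> x _; rewrite mule_ge0 // lee_fin sqnormc_ge0.
- by move=> x _; rewrite mule_ge0 // lee_fin.
apply: filterS (weight_ae0 mrho0 rho_pos) => x wx _.
rewrite /v /g' muleA -EFinM.
have [r0|rn0] := eqVneq (rho (phi x)) 0.
  by rewrite wx // /sqnormc /= expr0n addr0 !mul0r mul0e.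
by rewrite -mulrA divff // mulr1.
Qed.

End weighted_composition_operator.

(** * Multiplication operators and quadratic forms *)

Lemma conj_realM (R : realType) (a : R) (z : R[i]) :
  (a%:C%C * z)^* = a%:C%C * z^*.
Proof. by case: z => x y; rewrite /GRing.mul /= !mul0r !subr0 !addr0 mulrN. Qed.

Section multiplication.
Context d (X : measurableType d) (R : realType).
Variable mu : {measure set X -> \bar R}.
Implicit Types (F G : L2 mu) (f g : X -> R[i]) (h a : X -> R).

(** The maximal operator of multiplication by [h]. *)
Definition mulop h : set (L2 mu * L2 mu) :=
  [set p | represents p.2 (fun x => (h x)%:C%C * L2repr p.1 x)].

Lemma mulopE h F G f : represents F f ->
  mulop h (F, G) <-> represents G (fun x => (h x)%:C%C * f x).
Proof.
move=> Ff; split => hG; apply: represents_ae hG _.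
  by apply: filterS Ff => x e _ /=; rewrite e.
by apply: filterS Ff => x e _ /=; rewrite e.
Qed.

Lemma represents_le f g : cmeasurable f -> cmeasurable g ->
  (forall x, sqnormc (f x) <= sqnormc (g x)) -> square_integrable mu g ->
  exists F : L2 mu, represents F f.
Proof.
move=> mf mg fg Ig; apply: represents_exists => //.
apply: le_lt_trans Ig; apply: ge0_le_integral => //.
- by move=> x _; rewrite lee_fin sqnormc_ge0.
- exact: measurable_sqnormc.
- exact: measurable_sqnormc.
- by move=> x _; rewrite lee_fin.
Qed.

Lemma represents_mul_bounded F f a (M : R) : represents F f ->
  measurable_fun setT a -> (forall x, `|a x| <= M) ->
  exists G : L2 mu, represents G (fun x => (a x)%:C%C * f x).
Proof.
move=> Ff ma aM; have [G GF] := represents_mul_exists F ma aM.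
exists G; apply: represents_ae GF _.
by apply: filterS Ff => x e _; rewrite e.
Qed.

(** The operators whose quadratic form, with its domain, is that of
    multiplication by [h].  Both the weighted composition operators and their
    columns are of this kind, so that their [T^* T] are computed at once. *)
Definition form_density (K : lmodType R[i]) (ipK : K -> K -> R[i])
    (T : set (L2 mu * K)) h : Prop :=
  (forall F, opdom T F <->
     (\int[mu]_x (h x * sqnormc (L2repr F x))%:E < +oo)%E) /\
  (forall F (F' : K) G (G' : K), T (F, F') -> T (G, G') ->
     ipK F' G' = cintegral mu (fun x => (h x)%:C%C *
       (L2repr F x * (L2repr G x)^*))).

Lemma mulop_form_finite h F G : measurable_fun setT h -> (forall x, 0 <= h x) ->
  mulop h (F, G) -> (\int[mu]_x (h x * sqnormc (L2repr F x))%:E < +oo)%E.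
Proof.
move=> mh h0 FG.
have mhF : cmeasurable (fun x => (h x)%:C%C * L2repr F x).
  exact/cmeasurable_realM/cmeasurable_repr.
have Ih := represents_square_integrable mhF FG.
have mF : measurable_fun setT (fun x => (sqnormc (L2repr F x))%:E).
  exact/measurable_sqnormc/cmeasurable_repr.
apply: (@le_lt_trans _ _ (\int[mu]_x ((sqnormc (L2repr F x))%:E +
  (sqnormc ((h x)%:C%C * L2repr F x))%:E))%E).
  apply: ge0_le_integral => //.
  - by move=> x _; rewrite lee_fin mulr_ge0 ?sqnormc_ge0.
  - by apply/measurable_EFinP/measurable_funM => //; exact/measurable_EFinP.
  - by apply: emeasurable_funD => //; exact: measurable_sqnormc.
  - move=> x _; rewrite -EFinD lee_fin sqnormcM sqnormc_real.
    rewrite -[X in _ <= X + _]mul1r -mulrDl ler_wpM2r ?sqnormc_ge0 //.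
    have := sqr_ge0 (h x - 1); have := h0 x; nra.
rewrite ge0_integralD //.
- by rewrite lte_add_pinfty //; exact: square_integrable_repr.
- by move=> x _; rewrite lee_fin sqnormc_ge0.
- by move=> x _; rewrite lee_fin sqnormc_ge0.
- exact: measurable_sqnormc.
Qed.

Lemma cintegral_mulop h F G G' : measurable_fun setT h -> mulop h (G, G') ->
  cintegral mu (fun x => (h x)%:C%C * (L2repr F x * (L2repr G x)^*)) =
  L2dot mu F G'.
Proof.
move=> mh hG.
have mhG : cmeasurable (fun x => (h x)%:C%C * L2repr G x).
  exact/cmeasurable_realM/cmeasurable_repr.
rewrite (L2dotE (cmeasurable_repr F) mhG (represents_repr F) hG).
congr cintegral; apply/funext => x.
by rewrite conj_realM mulrCA.
Qed.

(** On functions supported by the indicator [a], the inner product only sees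
    the part of the other factor cut by [a]. *)
Lemma L2dot_cut a g F G : measurable_fun setT a ->
  represents F (fun x => (a x)%:C%C * L2repr F x) -> cmeasurable g ->
  represents G (fun x => (a x)%:C%C * g x) ->
  L2dot mu F G = cintegral mu (fun x => L2repr F x * (g x)^*).
Proof.
move=> ma Fa mg Gg; have mF := cmeasurable_repr F.
have mag : cmeasurable (fun x => (a x)%:C%C * g x) by exact: cmeasurable_realM.
rewrite (L2dotE mF mag (represents_repr F) Gg); apply: cintegral_ae.
- by apply: cmeasurableM => //; exact: cmeasurable_conj.
- by apply: cmeasurableM => //; exact: cmeasurable_conj.
- apply: filterS Fa => x e _; rewrite conj_realM.
  by rewrite mulrCA mulrA -e.
Qed.

(** Testing the relation that defines the adjoint against functions supported
    in [h <= n], on which all multiplications are bounded, identifies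
    [T^* T F] with [h F] there. *)
Lemma adjoint_comp_mulop (K : lmodType R[i]) (ipK : K -> K -> R[i])
    (T : set (L2 mu * K)) h :
  measurable_fun setT h -> (forall x, 0 <= h x) -> form_density ipK T h ->
  opcomp (adjoint (L2dot mu) ipK T) T = mulop h.
Proof.
move=> mh h0 [domT ipT]; apply/seteqP; split => -[F G] /=; last first.
  move=> hFG; have [k Tk] := (domT F).2 (mulop_form_finite mh h0 hFG).
  exists k; split => // -[p q] /= Tpq.
  by rewrite (ipT _ _ _ _ Tpq Tk) (cintegral_mulop _ mh hFG).
move=> [k [Tk adj]]; rewrite /= in Tk adj.
suff hn : forall n : nat,
    {ae mu, forall x, h x <= n%:R -> L2repr G x = (h x)%:C%C * L2repr F x}.
  apply: filterS (ae_foralln hn) => x {}hn _.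
  by apply: (hn (Num.bound (h x))); rewrite ltW // archi_boundP.
move=> n; pose a x : R := if h x <= n%:R then 1 else 0.
have ma : measurable_fun setT a.
  by apply: measurable_fun_ifT => //; exact: measurable_fun_ler.
have a1 x : `|a x| <= 1 by rewrite /a; case: ifP => _; rewrite ?normr1 ?normr0.
have ahn x : `|a x * h x| <= n%:R.
  by rewrite /a; case: ifP => hx;
    rewrite ?mul1r ?mul0r ?normr0 // ger0_norm.
have aa x : a x * a x = a x by rewrite /a; case: ifP => _; rewrite ?mul1r ?mul0r.
have mah : measurable_fun setT (fun x => a x * h x) by exact: measurable_funM.
have [Fn FnE] := represents_mul_exists F mah ahn.
have mhF : cmeasurable (fun x => (h x)%:C%C * L2repr F x).
  exact/cmeasurable_realM/cmeasurable_repr.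
have FnE' : represents Fn (fun x => (a x)%:C%C * ((h x)%:C%C * L2repr F x)).
  by apply: represents_ext FnE _ => x; rewrite mulrA -rmorphM.
have [Gn GnE] := represents_mul_exists G ma a1.
pose p := Fn - Gn.
have pE := representsB FnE GnE; rewrite -/p in pE.
have mFn : cmeasurable (fun x => (a x * h x)%:C%C * L2repr F x).
  exact/cmeasurable_realM/cmeasurable_repr.
have mGn : cmeasurable (fun x => (a x)%:C%C * L2repr G x).
  exact/cmeasurable_realM/cmeasurable_repr.
have pa : represents p (fun x => (a x)%:C%C * L2repr p x).
  apply: filterS pE => x e _; rewrite e // mulrBr !mulrA -!rmorphM /=.
  by rewrite mulrA aa.
have [q Tpq] : opdom T p.
  apply/domT; apply: (@le_lt_trans _ _ (n%:R%:E * L2sq p)%E); last first.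
    by rewrite lte_mul_pinfty ?lee_fin //; exact: square_integrable_repr.
  have msp : measurable_fun setT (fun x => (sqnormc (L2repr p x))%:E).
    exact/measurable_sqnormc/cmeasurable_repr.
  rewrite /L2sq -ge0_integralZl ?lee_fin //; last first.
    by move=> x _; rewrite lee_fin sqnormc_ge0.
  apply: ae_ge0_le_integral => //.
  - by move=> x _; rewrite lee_fin mulr_ge0 ?sqnormc_ge0.
  - by apply/measurable_EFinP/measurable_funM => //; exact/measurable_EFinP.
  - by move=> x _; rewrite mule_ge0 ?lee_fin ?sqnormc_ge0.
  - exact: emeasurable_funM.
  - apply: filterS pa => x e _; rewrite -EFinM lee_fin e // sqnormcM sqnormc_real.
    rewrite expr2 aa !mulrA ler_wpM2r ?sqnormc_ge0 // /a.
    by case: ifP => hx; rewrite ?mulr1 ?mulr0.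
have pp : L2dot mu p p = 0.
  rewrite L2dotBr (L2dot_cut ma pa mhF FnE') (L2dot_cut ma pa _ GnE); last first.
    exact: cmeasurable_repr.
  apply/eqP; rewrite subr_eq0; apply/eqP.
  have := adj _ Tpq; rewrite /= (ipT _ _ _ _ Tpq Tk) /L2dot => <-.
  congr cintegral; apply/funext => x.
  by rewrite conj_realM mulrCA.
have p0 := L2dot_eq0 pp; rewrite p0 in pE.
apply: filterS2 pE (represents0 mu) => x e1 e2 hx.
have := e1 I; rewrite e2 // /a hx /= mul1r => /esym/eqP.
by rewrite subr_eq0 !mul1r => /eqP ->.
Qed.

(** A sum of multiplications by nonnegative functions carries its natural
    domain, since each summand is dominated by the sum. *)
Lemma opadd_mulop h1 h2 : measurable_fun setT h1 -> measurable_fun setT h2 ->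
  (forall x, 0 <= h1 x) -> (forall x, 0 <= h2 x) ->
  opadd (mulop h1) (mulop h2) = mulop (fun x => h1 x + h2 x).
Proof.
move=> m1 m2 p1 p2; apply/seteqP; split => -[F G] /=.
  move=> [G1 [G2 [/= F1 F2 ->]]].
  apply: represents_ext (representsD F1 F2) _ => x.
  by rewrite -mulrDl -rmorphD.
move=> FG; have mFG : cmeasurable (fun x => (h1 x + h2 x)%:C%C * L2repr F x).
  by apply: cmeasurable_realM; [exact: measurable_funD|exact: cmeasurable_repr].
have sub_ex (k : X -> R) : measurable_fun setT k -> (forall x, 0 <= k x <= h1 x + h2 x) ->
    exists K : L2 mu, represents K (fun x => (k x)%:C%C * L2repr F x).
  move=> mk k0; apply: represents_le mFG _ (represents_square_integrable mFG FG).
    exact/cmeasurable_realM/cmeasurable_repr.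
  move=> x; rewrite !sqnormcM !sqnormc_real ler_wpM2r ?sqnormc_ge0 //.
  by have /andP[? ?] := k0 x; rewrite lerXn2r ?nnegrE // addr_ge0.
have [|G1 E1] := sub_ex h1 m1; first by move=> x; rewrite p1 lerDl p2.
have [|G2 E2] := sub_ex h2 m2; first by move=> x; rewrite p2 lerDr p1.
exists G1, G2; split => //=; apply: represents_inj FG _.
apply: represents_ext (representsD E1 E2) _ => x.
by rewrite -mulrDl -rmorphD.
Qed.

End multiplication.

Section form_density_column.
Context d (X : measurableType d) (R : realType).
Variable mu : {measure set X -> \bar R}.
Implicit Types (F G : L2 mu) (h : X -> R).

Let form_integrable h F G (u : X -> R) : measurable_fun setT h ->
  (forall x, 0 <= h x) -> measurable_fun setT u ->
  (forall x, `|u x| <= sqnormc (L2repr F x) + sqnormc (L2repr G x)) ->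
  (\int[mu]_x (h x * sqnormc (L2repr F x))%:E < +oo)%E ->
  (\int[mu]_x (h x * sqnormc (L2repr G x))%:E < +oo)%E ->
  mu.-integrable setT (fun x => (h x * u x)%:E).
Proof.
move=> mh h0 mu' uFG IF IG.
have int (K : L2 mu) : (\int[mu]_x (h x * sqnormc (L2repr K x))%:E < +oo)%E ->
    mu.-integrable setT (fun x => (h x * sqnormc (L2repr K x))%:E).
  move=> IK; apply/integrableP; split.
    apply/measurable_EFinP/measurable_funM => //.
    exact/measurable_EFinP/measurable_sqnormc/cmeasurable_repr.
  by under eq_integral do rewrite abse_EFin ger0_norm ?mulr_ge0 ?sqnormc_ge0 //.
apply: (@le_integrable _ _ _ mu setT measurableT _
  (fun x => (h x * sqnormc (L2repr F x))%:E + (h x * sqnormc (L2repr G x))%:E)%E).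
- by apply/measurable_EFinP/measurable_funM.
- move=> x _; rewrite -EFinD !abse_EFin lee_fin -mulrDr !normrM ler_wpM2l //.
  by rewrite [leRHS]ger0_norm // addr_ge0 ?sqnormc_ge0.
- by apply: integrableD => //; exact: int.
Qed.

Lemma form_density_column (T1 T2 : set (L2 mu * L2 mu)) h1 h2 :
  measurable_fun setT h1 -> measurable_fun setT h2 ->
  (forall x, 0 <= h1 x) -> (forall x, 0 <= h2 x) ->
  form_density (L2dot mu) T1 h1 -> form_density (L2dot mu) T2 h2 ->
  form_density (dotD (L2dot mu) (L2dot mu)) (opcolumn T1 T2)
    (fun x => h1 x + h2 x).
Proof.
move=> m1 m2 p1 p2 [dom1 ip1] [dom2 ip2]; split => [F|F [F1 F2] G [G1 G2]].
  have split_int : (\int[mu]_x ((h1 x + h2 x) * sqnormc (L2repr F x))%:E =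
      \int[mu]_x (h1 x * sqnormc (L2repr F x))%:E +
      \int[mu]_x (h2 x * sqnormc (L2repr F x))%:E)%E.
    have mF : measurable_fun setT (fun x => sqnormc (L2repr F x)).
      exact/measurable_EFinP/measurable_sqnormc/cmeasurable_repr.
    rewrite -ge0_integralD //.
    - by apply: eq_integral => x _; rewrite -EFinD mulrDl.
    - by move=> x _; rewrite lee_fin mulr_ge0 ?sqnormc_ge0.
    - by apply/measurable_EFinP/measurable_funM.
    - by move=> x _; rewrite lee_fin mulr_ge0 ?sqnormc_ge0.
    - by apply/measurable_EFinP/measurable_funM.
  rewrite split_int; split.
    move=> [[G1 G2] [/= T1F T2F]]; rewrite lte_add_pinfty //.
      by apply/dom1; exists G1.
    by apply/dom2; exists G2.
  have int0 (k : X -> R) : (forall x, 0 <= k x) ->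
      (0 <= \int[mu]_x (k x * sqnormc (L2repr F x))%:E)%E.
    by move=> k0; apply: integral_ge0 => x _; rewrite lee_fin mulr_ge0 ?sqnormc_ge0.
  move=> fin; have [|G1 T1F] := (dom1 F).2.
    by apply: le_lt_trans fin; rewrite leeDl ?int0.
  have [|G2 T2F] := (dom2 F).2.
    by apply: le_lt_trans fin; rewrite leeDr ?int0.
  by exists (G1, G2).
move=> [/= T1F T2F] [/= T1G T2G].
rewrite /dotD /= (ip1 _ _ _ _ T1F T1G) (ip2 _ _ _ _ T2F T2G) /cintegral.
have fin1F := (dom1 F).1 (ex_intro _ _ T1F).
have fin1G := (dom1 G).1 (ex_intro _ _ T1G).
have fin2F := (dom2 F).1 (ex_intro _ _ T2F).
have fin2G := (dom2 G).1 (ex_intro _ _ T2G).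
have [mRe mIm] := cmeasurable_dot F G.
apply/eqP; rewrite eq_complex /=; apply/andP; split; apply/eqP.
- under eq_Rintegral do rewrite Re_realM.
  under [X in _ + X = _]eq_Rintegral do rewrite Re_realM.
  under [RHS]eq_Rintegral do rewrite Re_realM mulrDl.
  by rewrite RintegralD //; apply: (@form_integrable _ F G) => // x;
    exact: normr_Re_mulJ.
- under eq_Rintegral do rewrite Im_realM.
  under [X in _ + X = _]eq_Rintegral do rewrite Im_realM.
  under [RHS]eq_Rintegral do rewrite Im_realM mulrDl.
  by rewrite RintegralD //; apply: (@form_integrable _ F G) => // x;
    exact: normr_Im_mulJ.
Qed.

End form_density_column.

Section wco_form.
Context d (X : measurableType d) (R : realType).
Variable mu : {sigma_finite_measure set X -> \bar R}.
Variables (phi : X -> X) (w : X -> R[i]) (h : X -> R).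
Hypotheses (mphi : measurable_fun setT phi) (mw : cmeasurable w).
Hypotheses (mh : measurable_fun setT h) (h0 : forall x, 0 <= h x).
Hypothesis hE : forall g : X -> \bar R, measurable_fun setT g ->
  (forall x, 0 <= g x)%E ->
  (\int[mu]_x ((sqnormc (w x))%:E * g (phi x)) =
   \int[mu]_x ((h x)%:E * g x))%E.

Let Rintegral_density (u : X -> R) : measurable_fun setT u ->
  \int[mu]_x (sqnormc (w x) * u (phi x)) = \int[mu]_x (h x * u x).
Proof.
move=> mu'; congr fine; rewrite integralE [RHS]integralE.
have pos (c : R) (y : R) : 0 <= c ->
    maxe (c * y)%:E 0%E = (c%:E * maxe y%:E 0)%E.
  by move=> c0; rewrite -!EFin_max -EFinM maxr_pMr // mulr0.
have muE : measurable_fun setT (EFin \o u) by exact/measurable_EFinP.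
congr (_ - _)%E.
- transitivity (\int[mu]_x ((sqnormc (w x))%:E * (EFin \o u)^\+ (phi x)))%E.
    by apply: eq_integral => x _; rewrite !funeposE /= pos ?sqnormc_ge0.
  rewrite hE //; last exact: measurable_funepos.
  by apply: eq_integral => x _; rewrite !funeposE /= pos.
- transitivity (\int[mu]_x ((sqnormc (w x))%:E * (EFin \o u)^\- (phi x)))%E.
    by apply: eq_integral => x _; rewrite !funenegE /= -mulrN pos ?sqnormc_ge0.
  rewrite hE //; last exact: measurable_funeneg.
  by apply: eq_integral => x _; rewrite !funenegE /= -mulrN pos.
Qed.

Lemma cmeasurable_wco (f : X -> R[i]) : cmeasurable f ->
  cmeasurable (fun x => w x * f (phi x)).
Proof. by move=> mf; apply: cmeasurableM => //; exact: cmeasurable_comp. Qed.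

Lemma wco_integral (f : X -> R[i]) : cmeasurable f ->
  (\int[mu]_x (sqnormc (w x * f (phi x)))%:E =
   \int[mu]_x (h x * sqnormc (f x))%:E)%E.
Proof.
move=> mf; under eq_integral do rewrite sqnormcM EFinM.
under [RHS]eq_integral do rewrite EFinM.
apply: (hE (g := fun x => (sqnormc (f x))%:E)); first exact: measurable_sqnormc.
by move=> x; rewrite lee_fin sqnormc_ge0.
Qed.

Lemma wco_form_density : form_density (L2dot mu) (wco mu phi w) h.
Proof.
have mF (F : L2 mu) := cmeasurable_repr F.
split => [F|F F' G G' FF' GG'].
  rewrite -wco_integral //; split => [[G FG]|fin].
    apply: represents_square_integrable FG; exact: cmeasurable_wco.
  by have [G GE] := represents_exists (cmeasurable_wco (mF F)) fin; exists G.
rewrite (L2dotE _ _ FF' GG'); try exact: cmeasurable_wco.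
have [mRe mIm] := cmeasurable_dot F G.
rewrite /cintegral; congr (_ +i* _)%C.
- under [RHS]eq_Rintegral do rewrite Re_realM.
  rewrite -Rintegral_density //; apply: eq_Rintegral => x _.
  case: (w x) (L2repr F _) (L2repr G _) => [a b] [e f] [p q].
  by rewrite /sqnormc /=; ring.
- under [RHS]eq_Rintegral do rewrite Im_realM.
  rewrite -Rintegral_density //; apply: eq_Rintegral => x _.
  case: (w x) (L2repr F _) (L2repr G _) => [a b] [e f] [p q].
  by rewrite /sqnormc /=; ring.
Qed.

End wco_form.

(** * Positive square roots of multiplication operators *)

Section weak_limits.
Context d (X : measurableType d) (R : realType).
Variable mu : {measure set X -> \bar R}.
Implicit Types (F G : L2 mu) (a u : X -> R).

Lemma Rintegral_mul_cvg u (a_ : nat -> X -> R) a :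
  mu.-integrable setT (EFin \o u) ->
  (forall n, measurable_fun setT (a_ n)) -> measurable_fun setT a ->
  (forall n x, `|a_ n x| <= 1) -> (forall x, a_ n x @[n --> \oo] --> a x) ->
  (\int[mu]_x (a_ n x * u x)) @[n --> \oo] --> \int[mu]_x (a x * u x).
Proof.
move=> iu ma_ ma a1 a_a; have mu' := measurable_int _ iu.
have mu'' : measurable_fun setT u by exact/measurable_EFinP.
have [|||||ia _ cv] := @dominated_convergence _ _ _ mu setT measurableT
  (fun n x => (a_ n x * u x)%:E) (fun x => (a x * u x)%:E)
  (fun x => `|u x|%:E).
- by move=> n; apply/measurable_EFinP/measurable_funM.
- by apply/measurable_EFinP/measurable_funM.
- apply: aeW => x _; apply/cvg_EFin; first exact: nearW.
  by apply: cvgM => //; exact: cvg_cst.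
- by have := integrable_abse iu; apply: eq_integrable => // x _.
- by apply: aeW => x n _; rewrite abse_EFin lee_fin normrM ler_piMl.
- apply: fine_cvg; rewrite fineK //.
  exact: integrable_fin_num.
Qed.

Lemma L2dot_mul_cvg F G (G_ : nat -> L2 mu) G' (a_ : nat -> X -> R) a :
  (forall n, measurable_fun setT (a_ n)) -> measurable_fun setT a ->
  (forall n x, `|a_ n x| <= 1) -> (forall x, a_ n x @[n --> \oo] --> a x) ->
  (forall n, represents (G_ n) (fun x => (a_ n x)%:C%C * L2repr G x)) ->
  represents G' (fun x => (a x)%:C%C * L2repr G x) ->
  (complex.Re (L2dot mu F (G_ n)) @[n --> \oo] --> complex.Re (L2dot mu F G')) /\
  (complex.Im (L2dot mu F (G_ n)) @[n --> \oo] --> complex.Im (L2dot mu F G')).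
Proof.
move=> ma_ ma a1 a_a G_E G'E.
have dotE (b : X -> R) (H : L2 mu) : measurable_fun setT b ->
    represents H (fun x => (b x)%:C%C * L2repr G x) ->
    L2dot mu F H = (\int[mu]_x (b x * complex.Re (L2repr F x * (L2repr G x)^*)) +i*
      \int[mu]_x (b x * complex.Im (L2repr F x * (L2repr G x)^*)))%C.
  move=> mb HE.
  rewrite (L2dotE (cmeasurable_repr F) _ (represents_repr F) HE); last first.
    exact/cmeasurable_realM/cmeasurable_repr.
  rewrite /cintegral; congr (_ +i* _)%C; apply: eq_Rintegral => x _;
    by rewrite conj_realM mulrCA ?Re_realM ?Im_realM.
rewrite (dotE a _ ma G'E); split.
- under eq_fun => n do rewrite (dotE (a_ n) _ (ma_ n) (G_E n)).
  by apply: Rintegral_mul_cvg => //; exact: integrable_Re_dot.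
- under eq_fun => n do rewrite (dotE (a_ n) _ (ma_ n) (G_E n)).
  by apply: Rintegral_mul_cvg => //; exact: integrable_Im_dot.
Qed.

(** An adjoint is closed under the weak limits that multiplication by a
    bounded pointwise convergent sequence produces. *)
Lemma adjoint_mul_closed (T : set (L2 mu * L2 mu)) F G F' G'
    (F_ G_ : nat -> L2 mu) (a_ : nat -> X -> R) a :
  (forall n, measurable_fun setT (a_ n)) -> measurable_fun setT a ->
  (forall n x, `|a_ n x| <= 1) -> (forall x, a_ n x @[n --> \oo] --> a x) ->
  (forall n, represents (F_ n) (fun x => (a_ n x)%:C%C * L2repr F x)) ->
  (forall n, represents (G_ n) (fun x => (a_ n x)%:C%C * L2repr G x)) ->
  represents F' (fun x => (a x)%:C%C * L2repr F x) ->
  represents G' (fun x => (a x)%:C%C * L2repr G x) ->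
  (forall n, adjoint (L2dot mu) (L2dot mu) T (F_ n, G_ n)) ->
  adjoint (L2dot mu) (L2dot mu) T (F', G').
Proof.
move=> ma_ ma a1 a_a F_E G_E F'E G'E adj [p q] Tpq /=.
have [Fre Fim] := L2dot_mul_cvg q ma_ ma a1 a_a F_E F'E.
have [Gre Gim] := L2dot_mul_cvg p ma_ ma a1 a_a G_E G'E.
have eqn n : L2dot mu q (F_ n) = L2dot mu p (G_ n) := adj n (p, q) Tpq.
have eqR : (fun n => complex.Re (L2dot mu q (F_ n))) =
    (fun n => complex.Re (L2dot mu p (G_ n))).
  by apply/funext => n; rewrite eqn.
have eqI : (fun n => complex.Im (L2dot mu q (F_ n))) =
    (fun n => complex.Im (L2dot mu p (G_ n))).
  by apply/funext => n; rewrite eqn.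
apply/eqP; rewrite eq_complex; apply/andP; split; apply/eqP.
- by rewrite eqR in Fre; apply: cvg_unique Fre Gre; exact: Rhausdorff.
- by rewrite eqI in Fim; apply: cvg_unique Fim Gim; exact: Rhausdorff.
Qed.

End weak_limits.

Section square_root_iteration.
Variable R : realType.

(** The iterates are polynomials in [t] that increase to the square root of [t]
    when [t] lies between [0] and [1]. *)
Fixpoint sqrt_iter (t : R) (n : nat) : R :=
  if n is m.+1 then sqrt_iter t m + 2^-1 * (t - sqrt_iter t m * sqrt_iter t m)
  else 0.

(** One step multiplies the error [y - q] by [1 - (y + q) / 2], which lies
    between [0] and [1 - y / 2]. *)
Lemma sqrt_iter_bound (y : R) n : 0 <= y <= 1 ->
  0 <= sqrt_iter (y ^+ 2) n <= y /\
  y - sqrt_iter (y ^+ 2) n <= y * (1 - y / 2) ^+ n.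
Proof.
move=> /andP[y0 y1]; elim: n => [|n [/andP[q0 qy] IH]] /=.
  by rewrite lexx y0 subr0 expr0 mulr1.
set q := sqrt_iter _ n in q0 qy IH *.
have step : y - (q + 2^-1 * (y ^+ 2 - q * q)) = (y - q) * (1 - (y + q) / 2).
  by field.
have k0 : 0 <= 1 - (y + q) / 2 by lra.
split; last first.
  rewrite step exprSr mulrA; apply: ler_pM => //; first by rewrite subr_ge0.
  lra.
apply/andP; split.
  by rewrite addr_ge0 // mulr_ge0 ?invr_ge0 // subr_ge0 expr2; nra.
by rewrite -subr_ge0 step mulr_ge0 // subr_ge0.
Qed.

Lemma sqrt_iter_cvg (y : R) : 0 <= y <= 1 ->
  sqrt_iter (y ^+ 2) n @[n --> \oo] --> y.
Proof.
move=> /[dup] y01 /andP[y0 y1].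
have [->|yn0] := eqVneq y 0.
  rewrite (_ : (fun n => _) = cst 0); first exact: cvg_cst.
  apply/funext => n; have [|/andP[q0 q0'] _] := @sqrt_iter_bound 0 n.
    by rewrite lexx ler01.
  by apply/eqP; rewrite eq_le q0 q0'.
have ypos : 0 < y by rewrite lt_def yn0.
have geo : y - y * (1 - y / 2) ^+ n @[n --> \oo] --> y.
  rewrite -[X in _ --> X]subr0; apply: cvgB; first exact: cvg_cst.
  rewrite -[X in _ --> X](mulr0 y); apply: cvgM; first exact: cvg_cst.
  apply: cvg_expr; rewrite ger0_norm; lra.
apply: (squeeze_cvgr _ geo (cvg_cst y)).
apply: nearW => n; have [/andP[_ ->] h] := sqrt_iter_bound n y01.
by rewrite andbT; lra.
Qed.

End square_root_iteration.

Section modulus_of_multiplication.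
Context d (X : measurableType d) (R : realType).
Variable mu : {measure set X -> \bar R}.
Variables (P : set (L2 mu * L2 mu)) (h : X -> R).
Hypothesis Psa : positive_selfadjoint (L2dot mu) P.
Hypotheses (mh : measurable_fun setT h) (h0 : forall x, 0 <= h x).
Hypothesis PP : opcomp P P = mulop h.

Implicit Types (F G : L2 mu) (a b : X -> R).

Let Pop : is_operator P. Proof. by case: Psa. Qed.
Let Padj : adjoint (L2dot mu) (L2dot mu) P = P. Proof. by case: Psa. Qed.

(** Commutation of a bounded multiplication operator with the unbounded [P]
    means that it maps the graph of [P] into itself. *)
Definition commuting a : Prop :=
  [/\ measurable_fun setT a, exists M : R, forall x, `|a x| <= M &
    forall F G F' G', P (F, G) ->
      represents F' (fun x => (a x)%:C%C * L2repr F x) ->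
      represents G' (fun x => (a x)%:C%C * L2repr G x) -> P (F', G')].

Lemma commutingM a b : commuting a -> commuting b ->
  commuting (fun x => a x * b x).
Proof.
move=> [ma [M aM] ca] [mb [N bN] cb]; split; first exact: measurable_funM.
  by exists (M * N) => x; rewrite normrM ler_pM.
move=> F G F' G' FG FF' GG'.
have [F1 F1E] := represents_mul_exists F mb bN.
have [G1 G1E] := represents_mul_exists G mb bN.
apply: (ca F1 G1); first exact: cb FG F1E G1E.
- apply: represents_ae FF' _; apply: filterS F1E => x e _.
  by rewrite e // rmorphM mulrA.
- apply: represents_ae GG' _; apply: filterS G1E => x e _.
  by rewrite e // rmorphM mulrA.
Qed.

Lemma commutingD a b (c : R) : commuting a -> commuting b ->
  commuting (fun x => a x + c * b x).
Proof.
move=> [ma [M aM] ca] [mb [N bN] cb]; split.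
- by apply: measurable_funD => //; exact: measurable_funM.
- exists (M + `|c| * N) => x.
  by rewrite (le_trans (ler_normD _ _)) // lerD // normrM ler_wpM2l.
move=> F G F' G' FG FF' GG'.
have [Fa FaE] := represents_mul_exists F ma aM.
have [Ga GaE] := represents_mul_exists G ma aM.
have [Fb FbE] := represents_mul_exists F mb bN.
have [Gb GbE] := represents_mul_exists G mb bN.
case: Pop => _ lin _.
have := lin c%:C%C _ _ (cb _ _ _ _ FG FbE GbE) (ca _ _ _ _ FG FaE GaE).
rewrite (_ : _ + _ = (F', G')) //; congr pair => /=.
- apply: represents_inj FF'.
  apply: represents_ext (representsD (representsZ _ FbE) FaE) _ => x.
  by rewrite addrC rmorphD rmorphM /= mulrDl mulrA.
- apply: represents_inj GG'.
  apply: represents_ext (representsD (representsZ _ GbE) GaE) _ => x.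
  by rewrite addrC rmorphD rmorphM /= mulrDl mulrA.
Qed.

Lemma commuting0 : commuting (cst 0).
Proof.
split; first exact: measurable_cst.
  by exists 0 => x; rewrite normr0.
move=> F G F' G' _ FF' GG'; case: Pop => P0 _ _.
suff -> : (F', G') = 0 by [].
congr pair.
- by apply: represents_inj FF' _; apply: represents_ext (represents0 mu) _ => x;
    rewrite mul0r.
- by apply: represents_inj GG' _; apply: represents_ext (represents0 mu) _ => x;
    rewrite mul0r.
Qed.

Lemma commuting_lim (a_ : nat -> X -> R) a : (forall n, commuting (a_ n)) ->
  (forall n x, `|a_ n x| <= 1) -> (forall x, a_ n x @[n --> \oo] --> a x) ->
  commuting a.
Proof.
move=> ca a1 a_a.
have ma_ n : measurable_fun setT (a_ n) by case: (ca n).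
have ma : measurable_fun setT a.
  by apply: (measurable_fun_cvg ma_) => x _; exact: a_a.
split => //.
  exists 1 => x; have /cvg_norm a_x := a_a x.
  rewrite -(cvg_lim _ a_x) //; apply: limr_le; first exact: cvgP a_x.
  by apply: nearW => n; exact: a1.
move=> F G F' G' FG FF' GG'.
have /choice[F_ F_E] n := represents_mul_exists F (ma_ n) (a1 n).
have /choice[G_ G_E] n := represents_mul_exists G (ma_ n) (a1 n).
rewrite -Padj; apply: (adjoint_mul_closed ma_ ma a1 a_a F_E G_E FF' GG') => n.
by rewrite Padj; have [_ _ /(_ _ _ _ _ FG (F_E n) (G_E n))] := ca n.
Qed.

(** Let [u = r f] with [r = 1 / (1 + h)], so that [P ^ 2 u = f - u].  If [f] is
    in the domain of [P], so is [P ^ 2 u], and applying [P] shows that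
    [v = P u] satisfies [v + P ^ 2 v = P f], that is [v = r P f]. *)
Lemma commuting_resolvent : commuting (fun x => (1 + h x)^-1).
Proof.
have h1 x : 0 < 1 + h x by rewrite ltr_pwDl.
have mr : measurable_fun setT (fun x => (1 + h x)^-1).
  by apply: measurable_inv_ge0 => [|x]; [exact: measurable_funD|exact: ltW].
have r1 x : `|(1 + h x)^-1| <= 1.
  rewrite ger0_norm; first by rewrite invf_le1 // lerDl.
  by rewrite invr_ge0; exact: ltW.
split => //; first by exists 1.
move=> F G F' G' FG FF' GG'.
have hF' : mulop h (F', F - F').
  apply/(mulopE _ _ FF').
  apply: represents_ext (representsB (represents_repr F) FF') _ => x.
  rewrite mulrA -rmorphM /= -{1}[L2repr F x]mul1r -mulrBl; congr (_ * _).
  rewrite -[1]/(1%:C%C) -rmorphB; congr (_%:C%C).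
  by have := lt0r_neq0 (h1 x); move=> n0; field.
have : opcomp P P (F', F - F') by rewrite PP.
move=> [V [/= PV PV']].
have hV : mulop h (V, G - V).
  by rewrite -PP; exists (F - F'); split => //=; exact: operatorB.
suff -> : G' = V by [].
apply: represents_inj GG' _; apply: represents_ae (represents_repr V) _.
have GV := representsB (represents_repr G) (represents_repr V).
apply: filterS2 hV GV => x /(_ I) /= e1 /(_ I) e2 _; move: e1; rewrite e2.
move=> /eqP; rewrite subr_eq => /eqP ->.
have -> : (h x)%:C%C * L2repr V x + L2repr V x = (1 + h x)%:C%C * L2repr V x.
  by rewrite rmorphD mulrDl mul1r addrC.
by rewrite mulrA -rmorphM /= mulVf ?mul1r // lt0r_neq0.
Qed.

Let r x : R := (1 + h x)^-1.
Let q x : R := Num.sqrt (h x).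
Let s x : R := q x * r x.

Let h1 x : 0 < 1 + h x. Proof. by rewrite ltr_pwDl. Qed.
Let r0 x : 0 <= r x. Proof. by rewrite invr_ge0 ltW. Qed.
Let q0 x : 0 <= q x. Proof. exact: sqrtr_ge0. Qed.
Let qq x : q x * q x = h x. Proof. by rewrite -expr2 sqr_sqrtr. Qed.
Let hr x : h x * r x = 1 - r x.
Proof. by rewrite /r; have := lt0r_neq0 (h1 x) => n0; field. Qed.

Let s_sq x : s x ^+ 2 = r x - r x * r x.
Proof.
rewrite expr2 /s mulrACA qq mulrA hr mulrBl mul1r //.
Qed.

Let s01 x : 0 <= s x <= 1.
Proof.
rewrite mulr_ge0 //= -(@ler_pXn2r _ 2) ?nnegrE ?mulr_ge0 ?ler01 //.
rewrite s_sq expr1n; have := sqr_ge0 (r x - 1); have := sqr_ge0 (r x + 1); nra.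
Qed.

(** [sqrt h / (1 + h)] is the square root of [r - r ^ 2], where [r] is the
    resolvent function, hence a limit of polynomials in [r]. *)
Lemma commuting_sqrt_resolvent : commuting s.
Proof.
apply: (@commuting_lim (fun n x => sqrt_iter (s x ^+ 2) n)).
- have cs : commuting (fun x => s x ^+ 2).
    have -> : (fun x => s x ^+ 2) = (fun x => r x + (-1) * (r x * r x)).
      by apply/funext => x; rewrite s_sq mulN1r.
    by apply: commutingD; [|apply: commutingM]; exact: commuting_resolvent.
  elim=> [|n IH] /=; first exact: commuting0.
  apply: commutingD => //.
  have := commutingD (-1) cs (commutingM IH IH).
  by under eq_fun do rewrite mulN1r.
- move=> n x; have [/andP[i0 i1] _] := sqrt_iter_bound n (s01 x).
  by rewrite ger0_norm // (le_trans i1) //; case/andP: (s01 x).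
- by move=> x; exact: sqrt_iter_cvg.
Qed.

(** With [Z = P F2 - sqrt h F2] for [F2 = r ^ 2 F], commutation gives
    [P Z = - sqrt h Z]; as both operators are positive, [P Z] and [sqrt h Z]
    vanish, and then [Z] is orthogonal to itself. *)
Lemma modulus_on_range F F2 S2 :
  represents F2 (fun x => (r x * r x)%:C%C * L2repr F x) ->
  represents S2 (fun x => (q x)%:C%C * L2repr F2 x) -> P (F2, S2).
Proof.
move=> F2E S2E.
have [mr [Mr rM] cr] := commuting_resolvent.
have [ms [Ms sM] cs] := commuting_sqrt_resolvent.
have mq : measurable_fun setT q by exact: measurable_sqrt_ge0.
have hr1 x : `|h x * r x| <= 1.
  rewrite ger0_norm ?mulr_ge0 // hr; have := r0 x; lra.
have [F1 F1E] := represents_mul_exists F mr rM.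
have [H1 H1E] := represents_mul_exists F (measurable_funM mh mr) hr1.
have : opcomp P P (F1, H1).
  rewrite PP; apply/(mulopE _ _ F1E).
  by apply: represents_ext H1E _ => x; rewrite mulrA -rmorphM.
move=> [V [/= PV PVH]].
have [RV RVE] := represents_mul_exists V mr rM.
have [RH RHE] := represents_mul_exists H1 mr rM.
have [SV SVE] := represents_mul_exists V ms sM.
have F2E' : represents F2 (fun x => (r x)%:C%C * L2repr F1 x).
  apply: represents_ae F2E _; apply: filterS F1E => x e _.
  by rewrite e // rmorphM mulrA.
have S2E' : represents S2 (fun x => (s x)%:C%C * L2repr F1 x).
  apply: represents_ae S2E _; apply: filterS F2E' => x e _.
  by rewrite e // mulrA -rmorphM.
have PF2 : P (F2, RV) := cr _ _ _ _ PV F2E' RVE.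
have PRV : P (RV, RH) := cr _ _ _ _ PVH RVE RHE.
have PS2 : P (S2, SV) := cs _ _ _ _ PV S2E' SVE.
pose Z := RV - S2; pose W := RH - SV.
have PZ : P (Z, W) := operatorB Pop PRV PS2.
have WZ : represents W (fun x => (- q x)%:C%C * L2repr Z x).
  apply: represents_ae (representsB RHE SVE) _.
  have ZE := representsB RVE S2E'.
  apply: filterS3 ZE H1E F1E => x eZ eH eF _.
  rewrite (eZ I) (eH I) (eF I) mulrBr rmorphN !mulNr opprK [RHS]addrC.
  congr (_ + _); rewrite !mulrA -!rmorphM /=.
    by congr (_%:C%C * _); rewrite /s -/(r x) -qq; ring.
  by congr (- _).
have mu_u : measurable_fun setT (fun x => q x * sqnormc (L2repr Z x)).
  apply: measurable_funM => //.
  exact/measurable_EFinP/measurable_sqnormc/cmeasurable_repr.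
have u0 x : 0 <= q x * sqnormc (L2repr Z x) by rewrite mulr_ge0 ?sqnormc_ge0.
have qZ0 : {ae mu, forall x, q x * sqnormc (L2repr Z x) = 0}.
  apply: integral_ge0_eq0 => //.
  pose I := (\int[mu]_x (complex.Re (L2repr W x * (L2repr Z x)^*))%:E)%E.
  have Ifin : I \is a fin_num.
    by apply: integrable_fin_num => //; exact: integrable_Re_dot.
  have IE : I = (- \int[mu]_x (q x * sqnormc (L2repr Z x))%:E)%E.
    rewrite -integral_ge0N; last by move=> x _; rewrite lee_fin.
    apply: ae_eq_integral => //.
    - by apply/measurable_EFinP; exact: (cmeasurable_dot W Z).1.
    - by apply: measurableT_comp => //; exact/measurable_EFinP.
    - apply: filterS WZ => x e _; rewrite e // -mulrA Re_realM Re_mulJ -EFinN.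
      by rewrite mulNr /sqnormc !expr2.
  have I0 : (0 <= I)%E.
    have [_ _ _ /(_ _ PZ)] := Psa.
    rewrite /= lecE => /andP[_ /=].
    by rewrite -[I]fineK.
  apply/eqP; rewrite eq_le -oppe_ge0 -IE I0 /=.
  by apply: integral_ge0 => x _; rewrite lee_fin.
have W0 : W = 0.
  apply: represents_inj WZ _; apply: represents_ae (represents0 mu) _.
  apply: filterS qZ0 => x /eqP; rewrite mulf_eq0 => /orP[/eqP->|/eqP/sqnormc_eq0->] _.
    by rewrite oppr0 mul0r.
  by rewrite mulr0.
have Z0 : Z = 0.
  apply: L2dot_eq0; rewrite {2}/Z L2dotBr.
  have : adjoint (L2dot mu) (L2dot mu) P (F2, RV) by rewrite Padj.
  move=> /(_ _ PZ) /= <-; rewrite W0 L2dot0l sub0r.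
  have mS : cmeasurable (fun x => (q x)%:C%C * L2repr F2 x).
    exact/cmeasurable_realM/cmeasurable_repr.
  rewrite (L2dotE (cmeasurable_repr Z) mS (represents_repr Z) S2E).
  have -> : cintegral mu (fun x => L2repr Z x * ((q x)%:C%C * L2repr F2 x)^*) =
      L2dot mu 0 F2.
    have m0 : cmeasurable (cst 0 : X -> R[i]) by split; exact: measurable_cst.
    rewrite (L2dotE m0 (cmeasurable_repr F2) (represents0 mu) (represents_repr F2)).
    apply: cintegral_ae.
    - by apply: cmeasurableM; [|apply: cmeasurable_conj]; try exact: cmeasurable_repr.
    - by apply: cmeasurableM => //; apply: cmeasurable_conj; exact: cmeasurable_repr.
    - apply: filterS qZ0 => x /eqP; rewrite mulf_eq0 conj_realM.
      by move=> /orP[/eqP->|/eqP/sqnormc_eq0->] _; rewrite !mul0r ?mulr0.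
  by rewrite L2dot0l oppr0.
suff -> : S2 = RV by [].
by apply/eqP; rewrite eq_sym -subr_eq0 -/Z Z0.
Qed.

(** The functions supported in [h <= n] lie in the range of the squared
    resolvent, so that the modulus acts on them as expected. *)
Lemma modulus_bounded (n : R) G G' :
  {ae mu, forall x, n < h x -> L2repr G x = 0} ->
  represents G' (fun x => (q x)%:C%C * L2repr G x) -> P (G, G').
Proof.
move=> Gn GG'; pose b x : R := if h x <= n then (1 + h x) * (1 + h x) else 0.
have mb : measurable_fun setT b.
  apply: measurable_fun_ifT => //; first exact: measurable_fun_ler.
  by apply: measurable_funM; exact: measurable_funD.
have bM x : `|b x| <= (1 + `|n|) * (1 + `|n|).
  rewrite /b; case: ifP => [hn|_]; last by rewrite normr0 mulr_ge0 ?addr_ge0.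
  have hn' : h x <= `|n| by rewrite (le_trans hn) ?ler_norm.
  rewrite ger0_norm; last by rewrite mulr_ge0 // addr_ge0.
  by apply: ler_pM; rewrite ?addr_ge0 ?lerD2l.
have [F FE] := represents_mul_exists G mb bM.
apply: (@modulus_on_range F) GG'.
apply: represents_ae (represents_repr G) _.
apply: filterS2 FE Gn => x e Gx _; rewrite (e I) /b.
case: ifP => hn; last by rewrite mul0r mulr0 Gx // ltNge hn.
rewrite mulrA -rmorphM /=.
have -> : r x * r x * ((1 + h x) * (1 + h x)) = 1.
  by rewrite mulrACA /r mulVf ?mulr1 // lt0r_neq0.
by rewrite mul1r.
Qed.

End modulus_of_multiplication.

(** * Commutation and invariance of the density *)

Section L2_norm_limits.
Context d (X : measurableType d) (R : realType).
Variable mu : {measure set X -> \bar R}.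
Implicit Types (F G : L2 mu) (a : X -> R).

Lemma L2sq_sub_le F G : fine (L2sq (F - G)%R) <=
  2 * fine (L2sq F) + 2 * fine (L2sq G).
Proof.
have mF := cmeasurable_repr F; have mG := cmeasurable_repr G.
rewrite -lee_fin EFinD !EFinM !fineK ?L2sq_fin //.
rewrite (L2sqE (cmeasurableB mF mG)); last first.
  by apply: representsB; exact: represents_repr.
have sq0 H : forall x, setT x -> (0 <= (sqnormc (L2repr H x))%:E)%E.
  by move=> x _; rewrite lee_fin sqnormc_ge0.
rewrite /L2sq -!ge0_integralZl //; try exact/measurable_sqnormc/cmeasurable_repr;
  try exact: sq0.
rewrite -ge0_integralD //; last 4 first.
- by move=> x _; rewrite mule_ge0 // lee_fin sqnormc_ge0.
- by apply: emeasurable_funM => //; exact: measurable_sqnormc.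
- by move=> x _; rewrite mule_ge0 // lee_fin sqnormc_ge0.
- by apply: emeasurable_funM => //; exact: measurable_sqnormc.
apply: ge0_le_integral => //.
- by move=> x _; rewrite lee_fin sqnormc_ge0.
- exact/measurable_sqnormc/cmeasurableB.
- by apply: emeasurable_funD; apply: emeasurable_funM => //; exact: measurable_sqnormc.
- by move=> x _; rewrite -!EFinM -EFinD lee_fin; exact: sqnormcB.
Qed.

Lemma L2sq_mul_cvg F F' (F_ : nat -> L2 mu) (a_ : nat -> X -> R) a :
  (forall n, measurable_fun setT (a_ n)) -> measurable_fun setT a ->
  (forall n x, `|a x - a_ n x| <= 1) -> (forall x, a_ n x @[n --> \oo] --> a x) ->
  (forall n, represents (F_ n) (fun x => (a_ n x)%:C%C * L2repr F x)) ->
  represents F' (fun x => (a x)%:C%C * L2repr F x) ->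
  fine (L2sq (F' - F_ n)%R) @[n --> \oo] --> (0 : R).
Proof.
move=> ma_ ma a1 a_a F_E F'E.
have msq : measurable_fun setT (fun x => (sqnormc (L2repr F x))%:E).
  exact/measurable_sqnormc/cmeasurable_repr.
have iF : mu.-integrable setT (EFin \o (fun x => sqnormc (L2repr F x))).
  apply/integrableP; split => //.
  under eq_integral do rewrite abse_EFin ger0_norm ?sqnormc_ge0 //.
  exact: square_integrable_repr.
pose b n x := (a x - a_ n x) ^+ 2.
have E n : fine (L2sq (F' - F_ n)%R) =
    \int[mu]_x (b n x * sqnormc (L2repr F x)).
  congr fine; rewrite (L2sqE _ (representsB F'E (F_E n))); last first.
    by apply: cmeasurableB; apply: cmeasurable_realM => //; exact: cmeasurable_repr.
  apply: eq_integral => x _.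
  by rewrite -mulrBl -rmorphB sqnormcM sqnormc_real.
rewrite (funext E).
have -> : (0 : R) = \int[mu]_x (0 * sqnormc (L2repr F x)).
  under eq_Rintegral do rewrite mul0r.
  by rewrite /Rintegral integral0.
apply: (Rintegral_mul_cvg (a_ := b) (a := cst 0)) => //.
- by move=> n; apply: measurable_funX; exact: measurable_funB.
- by move=> n x; rewrite /b normrX expr_le1.
- move=> x; rewrite (_ : cst 0 x = (a x - a x) ^+ 2); last by rewrite subrr expr0n.
  rewrite /b expr2; under eq_fun do rewrite expr2.
  by apply: cvgM; apply: cvgB => //; exact: cvg_cst.
Qed.

End L2_norm_limits.

Section component.
Context d (X : measurableType d) (R : realType).
Variable mu : {sigma_finite_measure set X -> \bar R}.
Variables (phi : X -> X) (w : X -> R[i]) (k h : X -> R).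
Hypotheses (mphi : measurable_fun setT phi) (mw : cmeasurable w).
Hypothesis ac : pushforward (weighted_measure mu w) phi `<< mu.
Hypotheses (mk : measurable_fun setT k) (k0 : forall x, 0 <= k x).
Hypothesis kE : forall g : X -> \bar R, measurable_fun setT g ->
  (forall x, 0 <= g x)%E ->
  (\int[mu]_x ((sqnormc (w x))%:E * g (phi x)) =
   \int[mu]_x ((k x)%:E * g x))%E.
Hypotheses (mh : measurable_fun setT h) (kh : forall x, k x <= h x).

Local Notation C := (wco mu phi w).
Implicit Types F G : L2 mu.

Let h0 x : 0 <= h x. Proof. exact: le_trans (kh x). Qed.

(** The pointwise condition to which all the commutation relations amount. *)
Definition weight_invariant : Prop :=
  {ae mu, forall x, w x != 0 -> h (phi x) = h x}.

Lemma wco_fun F G G' : C (F, G) -> C (F, G') -> G = G'.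
Proof. exact: represents_inj. Qed.

Lemma opdom_wco F :
  (\int[mu]_x (h x * sqnormc (L2repr F x))%:E < +oo)%E -> exists G, C (F, G).
Proof.
move=> fin; apply: ((wco_form_density mphi mw k0 kE).1 F).2.
apply: le_lt_trans fin; apply: ge0_le_integral => //.
- by move=> x _; rewrite lee_fin mulr_ge0 ?sqnormc_ge0.
- apply/measurable_EFinP/measurable_funM => //.
  exact/measurable_EFinP/measurable_sqnormc/cmeasurable_repr.
- apply/measurable_EFinP/measurable_funM => //.
  exact/measurable_EFinP/measurable_sqnormc/cmeasurable_repr.
- by move=> x _; rewrite lee_fin ler_wpM2r ?sqnormc_ge0.
Qed.

Lemma opdom_wco_mulop F G : mulop h (F, G) -> exists L, C (F, L).
Proof. by move=> FG; apply: opdom_wco; exact: mulop_form_finite FG. Qed.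

Lemma wco_eq0 F : {ae mu, forall x, h x != 0 -> L2repr F x = 0} -> C (F, 0).
Proof.
move=> F0; have mF := cmeasurable_repr F.
have kF0 : (\int[mu]_x (k x * sqnormc (L2repr F x))%:E = 0)%E.
  rewrite (ae_eq_integral (cst 0%E)) ?integral0 //.
    apply/measurable_EFinP/measurable_funM => //.
    exact/measurable_EFinP/measurable_sqnormc.
  apply: filterS F0 => x Fx _; have [hx|/Fx ->] := eqVneq (h x) 0.
    have -> : k x = 0 by apply/eqP; rewrite eq_le k0 -hx kh.
    by rewrite mul0r.
  by rewrite /sqnormc /= expr0n addr0 mulr0.
have [|G FG] := ((wco_form_density mphi mw k0 kE).1 F).2; first by rewrite kF0.
suff <- : G = 0 by [].
apply: L2sq_eq0; rewrite (L2sqE (cmeasurable_wco mphi mw mF) FG).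
by rewrite (wco_integral kE mF).
Qed.

(** On the indicator [E] of a set [B] of finite measure on which [h] is bounded
    the commutation relation reads [w (h 1_B) o phi = h w 1_B o phi], and
    countably many such [B] cover the space. *)
Lemma weight_invariant_test :
  (forall (n : R) (E K L M : L2 mu),
    {ae mu, forall x, n < h x -> L2repr E x = 0} ->
    mulop h (E, K) -> C (E, L) -> C (K, M) -> mulop h (L, M)) ->
  weight_invariant.
Proof.
move=> test; have /sigma_finiteP[A [AT Aincr /all_and2[mA Afin]]] :=
  sigma_finiteT mu.
suff hn : forall n : nat, {ae mu, forall x, h (phi x) <= n%:R -> A n (phi x) ->
    w x != 0 -> h (phi x) = h x}.
  apply: filterS (ae_foralln hn) => x {}hn wx.
  have [j _ Aj] : (\bigcup_i A i) (phi x) by rewrite -AT.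
  pose n := maxn j (Num.bound (h (phi x))).
  apply: (hn n) wx.
  - rewrite (le_trans (ltW (archi_boundP (h0 (phi x))))) // ler_nat leq_maxr //.
  - by have /subsetPset := Aincr _ _ (leq_maxl j (Num.bound (h (phi x)))); exact.
move=> n; pose b x : R := if h x <= n%:R then \1_(A n) x else 0.
have mb : measurable_fun setT b.
  by apply: measurable_fun_ifT => //; exact: measurable_fun_ler.
have b01 x : b x = 0 \/ b x = 1 /\ h x <= n%:R.
  rewrite /b indicE; case: ifP => hx; last by left.
  by case: (x \in A n); [right|left].
have bhM (c : X -> R) (M : R) : 0 <= M -> (forall x, h x <= n%:R -> `|c x| <= M) ->
    forall x, `|c x * b x| <= M.
  by move=> M0 cM x; case: (b01 x) => [->|[-> hx]]; rewrite ?mulr0 ?normr0 // mulr1; exact: cM.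
have [E EE] : exists E : L2 mu, represents E (fun x => (b x)%:C%C).
  apply: represents_exists; first exact: cmeasurable_real.
  rewrite /square_integrable.
  apply: (@le_lt_trans _ _ (\int[mu]_x (\1_(A n) x)%:E)%E); last first.
    by rewrite integral_indic // setIT; exact: Afin.
  apply: ge0_le_integral => //.
  - by move=> x _; rewrite lee_fin sqnormc_ge0.
  - exact/measurable_sqnormc/cmeasurable_real.
  - exact/measurable_EFinP/measurable_indic.
  - move=> x _; rewrite lee_fin sqnormc_real /b indicE.
    by case: ifP; case: (x \in A n); rewrite ?expr1n ?expr0n.
have n0 : 0 <= n%:R :> R by [].
have bounded_mult (c : X -> R) (M : R) : measurable_fun setT c -> 0 <= M ->
    (forall x, h x <= n%:R -> `|c x| <= M) ->
    exists K : L2 mu, represents K (fun x => (c x)%:C%C * (b x)%:C%C).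
  move=> mc M0 cM.
  have [K KE] := represents_mul_bounded EE (measurable_funM mc mb) (bhM c M M0 cM).
  exists K; apply: represents_ext KE _ => x.
  rewrite -!rmorphM /=; case: (b01 x) => [->|[-> _]]; by rewrite ?mulr0 ?mulr1.
have [K KE] := bounded_mult h n%:R mh n0
  (fun x hx => eq_ind_r (fun z => z <= n%:R) hx (ger0_norm (h0 x))).
have [H HE] := bounded_mult (fun x => h x * h x) (n%:R * n%:R)
  (measurable_funM mh mh) (mulr_ge0 n0 n0)
  (fun x hx => eq_ind_r (fun z => z <= n%:R * n%:R) (ler_pM (h0 x) (h0 x) hx hx)
    (ger0_norm (mulr_ge0 (h0 x) (h0 x)))).
have EK : mulop h (E, K) by apply/(mulopE _ _ EE).
have KH : mulop h (K, H).
  by apply/(mulopE _ _ KE); apply: represents_ext HE _ => x; rewrite rmorphM mulrA.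
have [L EL] := opdom_wco_mulop EK.
have [M KM] := opdom_wco_mulop KH.
have Esupp : {ae mu, forall x, n%:R < h x -> L2repr E x = 0}.
  by apply: filterS EE => x e hx; rewrite (e I) /b leNgt hx.
have LM := test _ _ _ _ _ Esupp EK EL KM.
have {}EL := (wcoE mphi mw ac L EE).1 EL.
have {}KM := (wcoE mphi mw ac M KE).1 KM.
have {}LM := (mulopE h M EL).1 LM.
apply: filterS2 KM LM => x /(_ I) e1 /(_ I) e2 hx Ax wx.
move: e2; rewrite e1 /b hx indicE mem_set // !mulr1 mulrC => /(mulIf wx).
by case.
Qed.

Lemma wco_commutes_mulop : weight_invariant ->
  opcomp C (mulop h) `<=` opcomp (mulop h) C.
Proof.
move=> inv [F M] [K [/= FK KM]]; have [L FL] := opdom_wco_mulop FK.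
exists L; split => //=; apply/(mulopE _ _ FL).
apply: represents_ae ((wcoE mphi mw ac M FK).1 KM) _.
apply: filterS inv => x inv _; have [->|wx] := eqVneq (w x) 0.
  by rewrite !mul0r mulr0.
by rewrite inv // mulrCA.
Qed.
Variables (P : set (L2 mu * L2 mu)) (U : L2 mu -> L2 mu).
Hypothesis Psa : positive_selfadjoint (L2dot mu) P.
Hypothesis PP : opcomp P P = mulop h.
Hypothesis UB : forall F G, U (F - G) = U F - U G.
Hypothesis Ubounded : exists m : R, forall F,
  fine (L2sq (U F)) <= m * fine (L2sq F).
Hypothesis Uker : forall F, {ae mu, forall x, h x != 0 -> L2repr F x = 0} ->
  U F = 0.
Hypothesis UC : forall F G, P (F, G) -> C (F, U G).

Let q x : R := Num.sqrt (h x).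

(** [P] multiplies by [sqrt h] the functions supported in [h <= n], so the
    commutation of [U] with [P], used twice along [E], [sqrt h E], [h E],
    gives [P ^ 2 (C E) = C (P ^ 2 E)]. *)
Lemma weight_invariant_of_commutes :
  opcomp (graph_of U) P `<=` opcomp P (graph_of U) -> weight_invariant.
Proof.
move=> sub; apply: weight_invariant_test => n E K L M Esupp EK EL KM.
have mq : measurable_fun setT q by exact: measurable_sqrt_ge0.
have qq x : q x * q x = h x by rewrite -expr2 sqr_sqrtr.
have mulq F : {ae mu, forall x, n < h x -> L2repr F x = 0} ->
    exists G, [/\ represents G (fun x => (q x)%:C%C * L2repr F x),
      {ae mu, forall x, n < h x -> L2repr G x = 0} & P (F, G)].
  move=> Fsupp; pose c x : R := if h x <= n then q x else 0.
  have mc : measurable_fun setT c.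
    by apply: measurable_fun_ifT => //; exact: measurable_fun_ler.
  have cM x : `|c x| <= Num.sqrt n.
    rewrite /c; case: ifP => hx; last by rewrite normr0 sqrtr_ge0.
    by rewrite ger0_norm ?sqrtr_ge0 // ler_wsqrtr.
  have [G GE] := represents_mul_exists F mc cM.
  have GE' : represents G (fun x => (q x)%:C%C * L2repr F x).
    apply: represents_ae GE _; apply: filterS Fsupp => x Fx _; rewrite /c.
    by case: ifP => // hx; rewrite Fx ?mulr0 // ltNge hx.
  exists G; split => //; last exact: modulus_bounded Fsupp GE'.
  by apply: filterS2 GE' Fsupp => x e Fx hx; rewrite (e I) Fx ?mulr0.
have [J [JE Jsupp PEJ]] := mulq _ Esupp.
have [K1 [K1E Ksupp PJK1]] := mulq _ Jsupp.
have eK : K1 = K.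
  apply: represents_inj EK; apply: represents_ae K1E _.
  by apply: filterS JE => x e _; rewrite (e I) mulrA -rmorphM /= qq.
rewrite eK in Ksupp PJK1.
have [K' [_ _ PKK']] := mulq _ Ksupp.
have eL : L = U J := wco_fun EL (UC PEJ).
have eM : M = U K' := wco_fun KM (UC PKK').
have commU F G : P (F, G) -> P (U F, U G).
  move=> FG; have /sub[z [zE Pz]] : opcomp (graph_of U) P (F, U G) by exists G.
  by rewrite -(zE : z = U F).
by rewrite -PP eL eM; exists (U K); split; exact: commU.
Qed.

(** If [h] is invariant, commutation holds on the functions
    [F_n = 1_(1/n <= h <= n) F], which are [P N_n] for [N_n = h^(-1/2) F_n];
    it extends to [F] since [U] is bounded and [P] closed. *)
Lemma commutes_of_weight_invariant : weight_invariant ->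
  opcomp (graph_of U) P `<=` opcomp P (graph_of U).
Proof.
move=> inv [F G] [V [/= PFV GE]]; exists (U F); split => //=.
have CF : C (F, G) by rewrite (GE : G = U V); exact: UC.
have mq : measurable_fun setT q by exact: measurable_sqrt_ge0.
have qq x : q x * q x = h x by rewrite -expr2 sqr_sqrtr.
have q0 x : 0 <= q x by exact: sqrtr_ge0.
pose an n x : R := if (n.+1%:R^-1 <= h x) && (h x <= n%:R) then 1 else 0.
pose a x : R := if 0 < h x then 1 else 0.
have man n : measurable_fun setT (an n).
  apply: measurable_fun_ifT => //.
  by apply: measurable_and; exact: measurable_fun_ler.
have ma : measurable_fun setT a.
  by apply: measurable_fun_ifT => //; exact: measurable_fun_ltr.
have an1 n x : `|an n x| <= 1.
  by rewrite /an; case: ifP; rewrite ?normr1 ?normr0.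
have a1 x : `|a x| <= 1 by rewrite /a; case: ifP; rewrite ?normr1 ?normr0.
have aan n x : `|a x - an n x| <= 1.
  rewrite /a /an; case: ifP; case: ifP => _ _;
    by rewrite ?subrr ?subr0 ?sub0r ?normrN ?normr1 ?normr0.
have an_a x : an n x @[n --> \oo] --> a x.
  rewrite /a; case: ifP => hx; last first.
    rewrite (_ : (fun n => _) = cst 0); first exact: cvg_cst.
    apply/funext => n; rewrite /an; case: ifP => // /andP[hn _].
    by move: hx; rewrite (lt_le_trans _ hn) // invr_gt0.
  apply: cvg_near_cst; near=> n.
  rewrite /an ifT //; apply/andP; split.
    near: n; have [m _ hm] := near_infty_natSinv_lt (PosNum hx).
    by exists m => // j mj; exact/ltW/(hm j mj).
  near: n; exists (Num.bound (h x)) => // j /= mj.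
  by rewrite (le_trans (ltW (archi_boundP (h0 x)))) // ler_nat.
have anq n x : an n x * (q x * (q x)^-1) = an n x.
  rewrite /an; case: ifP => [/andP[hn _]|_]; last by rewrite mul0r.
  rewrite divff ?mulr1 // gt_eqF // sqrtr_gt0.
  by apply: (lt_le_trans _ hn); rewrite invr_gt0.
have mqV : measurable_fun setT (fun x => (q x)^-1) by exact: measurable_inv_ge0.
pose c n x := an n x * (q x)^-1.
have mc n : measurable_fun setT (c n) by exact: measurable_funM.
have cM n x : `|c n x| <= Num.sqrt n.+1%:R.
  rewrite /c /an; case: ifP => [/andP[hn _]|_]; last first.
    by rewrite mul0r normr0 sqrtr_ge0.
  rewrite mul1r ger0_norm ?invr_ge0 // /q -sqrtrV ?h0 // ler_wsqrtr //.
  have hpos : 0 < h x by apply: (lt_le_trans _ hn); rewrite invr_gt0.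
  by rewrite -[leRHS]invrK lef_pV2 // posrE invr_gt0.
(* the value of [U F], because [C = U P] and [P] multiplies by [sqrt h] *)
pose g0 x := w x * ((q (phi x))^-1%:C%C * L2repr F (phi x)).
have mqF : cmeasurable (fun x => (q x)^-1%:C%C * L2repr F x).
  exact/cmeasurable_realM/cmeasurable_repr.
have [G0 G0E] : exists G0 : L2 mu, represents G0 g0.
  apply: represents_exists; first exact: (cmeasurable_wco mphi mw mqF).
  rewrite /square_integrable (wco_integral kE mqF).
  apply: (@le_lt_trans _ _ (L2sq F)); last exact: square_integrable_repr.
  apply: ge0_le_integral => //.
  - by move=> x _; rewrite lee_fin mulr_ge0 ?sqnormc_ge0.
  - apply/measurable_EFinP/measurable_funM => //.
    exact/measurable_EFinP/measurable_sqnormc.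
  - exact/measurable_sqnormc/cmeasurable_repr.
  - move=> x _; rewrite lee_fin sqnormcM sqnormc_real mulrA.
    rewrite ler_piMl ?sqnormc_ge0 //.
    have [qx0|qx0] := eqVneq (q x) 0; first by rewrite qx0 invr0 expr0n mulr0.
    rewrite exprVn expr2 qq ler_pdivrMr ?mul1r ?kh //.
    by rewrite lt_def h0 andbT -qq mulf_neq0.
have /choice[Fn FnE] n := represents_mul_exists F (man n) (an1 n).
have /choice[Nn NnE] n := represents_mul_exists F (mc n) (cM n).
have PNF n : P (Nn n, Fn n).
  apply: (modulus_bounded Psa mh h0 PP (n := n%:R)).
    apply: filterS (NnE n) => x e hx; rewrite (e I) /c /an.
    by rewrite (leNgt (h x)) hx andbF mul0r mul0r.
  apply: represents_ae (FnE n) _; apply: filterS (NnE n) => x e _.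
  by rewrite (e I) mulrA -rmorphM /= /c mulrCA anq.
have UFnE n : represents (U (Fn n)) (fun x => (an n (phi x))%:C%C * L2repr G0 x).
  apply: represents_ae ((wcoE mphi mw ac _ (NnE n)).1 (UC (PNF n))) _.
  apply: filterS G0E => x e _.
  rewrite (e I) /g0 /c rmorphM /=; ring.
have manphi n : measurable_fun setT (an n \o phi) by exact: measurableT_comp.
have maphi : measurable_fun setT (a \o phi) by exact: measurableT_comp.
have /choice[Gn GnE] n := represents_mul_exists G (manphi n) (fun x => an1 n (phi x)).
have PUG n : P (U (Fn n), Gn n).
  apply: (modulus_bounded Psa mh h0 PP (n := n%:R)).
    apply: filterS3 (UFnE n) G0E inv => x e1 e2 hinv hx.
    rewrite (e1 I) (e2 I) /g0; have [->|wx] := eqVneq (w x) 0.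
      by rewrite mul0r mulr0.
    by rewrite /an hinv // (leNgt (h x)) hx andbF mul0r.
  apply: represents_ae (GnE n) _.
  have UFn : {ae mu, forall x,
      L2repr (U (Fn n)) x = (an n (phi x))%:C%C * g0 x}.
    by apply: filterS2 (UFnE n) G0E => x e1 e2; rewrite (e1 I) (e2 I).
  apply: filterS3 UFn CF inv => x e1 e2 hinv _.
  rewrite e1 (e2 I) /g0 /=; have [->|wx] := eqVneq (w x) 0.
    by rewrite !mul0r !mulr0.
  have qphi : q x = q (phi x) by rewrite /q hinv.
  by rewrite -/(q x) qphi -{1}(anq n (phi x)) !rmorphM /=; ring.
(* the image measure does not charge [h = 0], since its density is at most [h] *)
have w0 : {ae mu, forall x, h (phi x) = 0 -> w x = 0}.
  pose z x : R := if h x <= 0 then 1 else 0.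
  have mz : measurable_fun setT z.
    by apply: measurable_fun_ifT => //; exact: measurable_fun_ler.
  have z0 x : 0 <= z x by rewrite /z; case: ifP.
  have : {ae mu, forall x, sqnormc (w x) * z (phi x) = 0}.
    apply: integral_ge0_eq0.
    - apply: measurable_funM; first exact/measurable_EFinP/measurable_sqnormc.
      exact: measurableT_comp.
    - by move=> x; rewrite mulr_ge0 ?sqnormc_ge0.
    - under eq_integral do rewrite EFinM.
      rewrite (kE (g := fun x => (z x)%:E)); last 2 first.
      + exact/measurable_EFinP.
      + by move=> x; rewrite lee_fin.
      rewrite (eq_integral (cst 0%E)) ?integral0 // => x _.
      rewrite -EFinM /z; case: ifP => hx; last by rewrite mulr0.
      suff -> : k x = 0 by rewrite mul0r.
      by apply/eqP; rewrite eq_le k0 (le_trans (kh x)).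
  apply: filterS => x + hx; rewrite /z hx lexx mulr1; exact: sqnormc_eq0.
have aphi (g : X -> R[i]) (H : L2 mu) : represents H (fun x => w x * g x) ->
    represents H (fun x => (a (phi x))%:C%C * L2repr H x).
  move=> HE; apply: represents_ae (represents_repr H) _.
  apply: filterS2 HE w0 => x e wx _; rewrite /a; case: ifP => hx.
    by rewrite mul1r.
  by rewrite (e I) wx ?mul0r ?mulr0 //; apply/eqP; rewrite eq_le h0 leNgt hx.
have PG0 : P (G0, G).
  have Padj : adjoint (L2dot mu) (L2dot mu) P = P by case: Psa.
  rewrite -Padj; apply: (adjoint_mul_closed manphi maphi) UFnE GnE _ _ _.
  - by move=> n x; exact: an1.
  - by move=> x; exact: an_a.
  - exact: aphi G0E.
  - exact: aphi CF.
  - by move=> n; rewrite Padj.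
suff -> : U F = G0 by [].
have [Fa FaE] := represents_mul_exists F ma a1.
have -> : U F = U Fa.
  apply/eqP; rewrite -subr_eq0 -UB; apply/eqP/Uker.
  have FB := representsB (represents_repr F) FaE.
  apply: filterS FB => x e hx; rewrite (e I) /a lt_def hx h0 /=.
  by rewrite mul1r subrr.
have [m Um] := Ubounded.
have cvgF : fine (L2sq (Fa - Fn n)%R) @[n --> \oo] --> (0 : R).
  exact: (L2sq_mul_cvg man ma aan an_a FnE FaE).
have cvgG : fine (L2sq (G0 - U (Fn n))%R) @[n --> \oo] --> (0 : R).
  apply: (L2sq_mul_cvg manphi maphi) UFnE (aphi _ _ G0E).
  - by move=> n x; exact: aan.
  - by move=> x; exact: an_a.
have sq0 : fine (L2sq (U Fa - G0)%R) <= 0.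
  have cvgS : 2 * (m * fine (L2sq (Fa - Fn n)%R)) +
      2 * fine (L2sq (G0 - U (Fn n))%R) @[n --> \oo] --> (0 : R).
    rewrite -[X in _ --> X](_ : 2 * (m * 0) + 2 * 0 = 0); last by rewrite !mulr0 addr0.
    by apply: cvgD; apply: cvgM; [exact: cvg_cst|apply: cvgM|exact: cvg_cst|];
      try exact: cvg_cst.
  rewrite -(cvg_lim _ cvgS) //; apply: limr_ge; first exact: cvgP cvgS.
  apply: nearW => n.
  have -> : U Fa - G0 = (U Fa - U (Fn n)) - (G0 - U (Fn n)).
    by rewrite opprB addrA subrK.
  apply: (le_trans (L2sq_sub_le _ _)); rewrite lerD2r ler_wpM2l //.
  by rewrite -UB.
apply/eqP; rewrite -subr_eq0; apply/eqP/L2sq_eq0.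
rewrite -(fineK (L2sq_fin _)); congr EFin; apply/eqP; rewrite eq_le sq0 /=.
exact: fine_L2sq_ge0.
Unshelve. all: by end_near.
Qed.

End component.

(** * The spherical mean transform *)

Section mean_transform.
Variables (R : realType) (H : lmodType R[i]) (P : set (H * H)).
Hypothesis Pop : is_operator P.
Variable lambda : R.
Hypothesis lambda1 : lambda < 1.
Implicit Type U : H -> H.

Let lambda_split (v : H) : lambda%:C%C *: v + (1 - lambda)%:C%C *: v = v.
Proof. by rewrite -scalerDl -rmorphD addrC subrK scale1r. Qed.

Lemma mean_componentE U f g : mean_component lambda U P (f, g) <->
  exists v u, [/\ P (f, v), P (U f, u) &
    g = lambda%:C%C *: U v + (1 - lambda)%:C%C *: u].
Proof.
split.
  move=> [a [b [[c [[v [/= Pv Uv]] ac]] [e [[y [Uy Py]] be]] ->]]].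
  exists v, e; split => //; first by rewrite -(Uy : y = U f).
  by rewrite (ac : a = _) (be : b = _) (Uv : c = U v).
move=> [v [u [Pv Pu ->]]].
exists (lambda%:C%C *: U v), ((1 - lambda)%:C%C *: u); split => //.
  by exists (U v); split => //; exists v.
by exists u; split => //; exists (U f).
Qed.

(** Both [U v] and the mean have the same first summand [lambda U v], and the
    remaining coefficient [1 - lambda] is invertible. *)
Lemma mean_component_commutes U v f :
  P (f, v) -> mean_component lambda U P (f, U v) -> P (U f, U v).
Proof.
move=> Pv /mean_componentE[v' [u [Pv' Pu]]].
rewrite -(operator_inj Pop Pv Pv') -{1}[U v]lambda_split => /addrI.
have l0 : (1 - lambda)%:C%C != 0 :> R[i].
  by rewrite -[0]/(0%:C%C) (inj_eq (@complexI R)) subr_eq0 gt_eqF.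
by move=> /(scalerI l0) ->.
Qed.

Lemma commutes_mean_component U : opcomp (graph_of U) P `<=` opcomp P (graph_of U) ->
  mean_component lambda U P = opcomp (graph_of U) P.
Proof.
move=> sub; have commU f v : P (f, v) -> P (U f, U v).
  move=> Pv; have /sub[z [zE Pz]] : opcomp (graph_of U) P (f, U v) by exists v.
  by rewrite -(zE : z = U f).
apply/seteqP; split => -[f g].
  move=> /mean_componentE[v [u [Pv Pu ->]]]; exists v; split => //=.
  by rewrite -(operator_inj Pop (commU _ _ Pv) Pu) lambda_split.
move=> [v [/= Pv gE]]; apply/mean_componentE; exists v, (U v); split => //.
  exact: commU.
by rewrite lambda_split (gE : g = U v).
Qed.

End mean_transform.

(** The norm bound [M] is a priori an arbitrary complex number; replacing it by
    its modulus gives a real bound for the squared norms. *)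
Lemma partial_isometry_L2sq d (X : measurableType d) (R : realType)
    (mu : {measure set X -> \bar R}) (U1 U2 : L2 mu -> L2 mu) :
  partial_isometry (L2dot mu) (dotD (L2dot mu) (L2dot mu))
    (fun f => (U1 f, U2 f)) ->
  exists m : R, forall f, fine (L2sq (U1 f)) + fine (L2sq (U2 f)) <=
    m * fine (L2sq f).
Proof.
move=> [_ [M UM] _]; exists (sqnormc M) => f.
have := UM f; rewrite /dotD /= !L2dot_sq -rmorphD /=.
set x := _ + _; set y := fine (L2sq f) => xy.
have x0 : (0 : R[i]) <= x%:C%C by rewrite lecR addr_ge0 ?fine_L2sq_ge0.
have y0 : (0 : R[i]) <= y%:C%C by rewrite lecR fine_L2sq_ge0.
have My0 : 0 <= M * sqrtC y%:C%C by apply: le_trans xy; rewrite sqrtC_ge0.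
rewrite -lecR rmorphM /= sqnormcE -(sqrtCK y%:C%C) -(sqrtCK x%:C%C).
rewrite -[sqrtC y%:C%C]ger0_norm ?sqrtC_ge0 // -exprMn -normrM ger0_norm //.
by rewrite lerXn2r // nnegrE ?sqrtC_ge0.
Qed.

Theorem corollary31 (R : realType) (d : measure_display) (X : measurableType d)
    (mu : {sigma_finite_measure set X -> \bar R})
    (phi1 phi2 : X -> X) (w1 w2 : X -> R[i])
    (mphi1 : measurable_fun setT phi1) (mphi2 : measurable_fun setT phi2)
    (mw1 : cmeasurable w1) (mw2 : cmeasurable w2)
    (ac1 : pushforward (weighted_measure mu w1) phi1 `<< mu)
    (ac2 : pushforward (weighted_measure mu w2) phi2 `<< mu)
    (dd1 : densely_defined (L2dot mu) (wco mu phi1 w1))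
    (dd2 : densely_defined (L2dot mu) (wco mu phi2 w2))
    (U1 U2 : L2 mu -> L2 mu) (P : set (L2 mu * L2 mu))
    (polar : is_polar_decomposition (L2dot mu)
      (dotD (L2dot mu) (L2dot mu))
      (opcolumn (wco mu phi1 w1) (wco mu phi2 w2))
      (fun f => (U1 f, U2 f)) P)
    (lambda : R) (lambda0 : 0 < lambda) (lambda1 : lambda < 1) :
  let C1 := wco mu phi1 w1 in
  let C2 := wco mu phi2 w2 in
  let A := opadd (opcomp (adjoint (L2dot mu) (L2dot mu) C1) C1)
                 (opcomp (adjoint (L2dot mu) (L2dot mu) C2) C2) in
  [<-> opcolumn (mean_component lambda U1 P) (mean_component lambda U2 P)
         = opcolumn C1 C2;
       opcomp (graph_of U1) P `<=` opcomp P (graph_of U1) /\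
       opcomp (graph_of U2) P `<=` opcomp P (graph_of U2);
       opcomp C1 (opcomp P P) `<=` opcomp (opcomp P P) C1 /\
       opcomp C2 (opcomp P P) `<=` opcomp (opcomp P P) C2;
       opcomp C1 A `<=` opcomp A C1 /\ opcomp C2 A `<=` opcomp A C2].

Proof.
move=> C1 C2 A.
have [k1 [mk1 k10 k1E]] := wco_density mphi1 mw1 ac1 dd1.
have [k2 [mk2 k20 k2E]] := wco_density mphi2 mw2 ac2 dd2.
pose h x := k1 x + k2 x.
have mh : measurable_fun setT h by exact: measurable_funD.
have h0 x : 0 <= h x by rewrite addr_ge0.
have kh1 x : k1 x <= h x by rewrite lerDl.
have kh2 x : k2 x <= h x by rewrite lerDr.
have form1 := wco_form_density mphi1 mw1 k10 k1E.
have form2 := wco_form_density mphi2 mw2 k20 k2E.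
have [[Psa PPadj] Upi Uker TE] := polar.
have [Ulin _ _] := Upi.
have PP : opcomp P P = mulop h.
  rewrite PPadj; apply: adjoint_comp_mulop => //.
  exact: form_density_column.
have AE : A = mulop h.
  by rewrite /A !(adjoint_comp_mulop _ _ form1, adjoint_comp_mulop _ _ form2) // opadd_mulop.
have Pop : is_operator P by case: Psa.
have UB F G : U1 (F - G) = U1 F - U1 G /\ U2 (F - G) = U2 F - U2 G.
  have := Ulin (-1) G F; rewrite scaleN1r (addrC (- G)) => -[-> ->].
  by rewrite !scaleN1r !(addrC (- _)).
have [m Um] := partial_isometry_L2sq Upi.
have Um1 : exists m : R, forall F, fine (L2sq (U1 F)) <= m * fine (L2sq F).
  by exists m => F; apply: le_trans (Um F); rewrite lerDl fine_L2sq_ge0.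
have Um2 : exists m : R, forall F, fine (L2sq (U2 F)) <= m * fine (L2sq F).
  by exists m => F; apply: le_trans (Um F); rewrite lerDr fine_L2sq_ge0.
have Uker0 F : {ae mu, forall x, h x != 0 -> L2repr F x = 0} ->
    U1 F = 0 /\ U2 F = 0.
  move=> F0; have [_ Uk] := Uker F.
  have : opcolumn C1 C2 (F, 0).
    split => /=.
    - exact: (wco_eq0 mphi1 mw1 mk1 k10 k1E kh1 F0).
    - exact: (wco_eq0 mphi2 mw2 mk2 k20 k2E kh2 F0).
  by move=> /Uk [-> ->].
have UC F G : P (F, G) -> C1 (F, U1 G) /\ C2 (F, U2 G).
  move=> FG; have : opcolumn C1 C2 (F, (U1 G, U2 G)) by rewrite TE; exists G.
  by case.
have ii_inv := (weight_invariant_of_commutes mphi1 mw1 ac1 mk1 k10 k1E mh kh1 Psa PP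
  (fun F G H => (UC F G H).1), weight_invariant_of_commutes mphi2 mw2 ac2 mk2 k20 k2E mh kh2 Psa PP
  (fun F G H => (UC F G H).2)).
have inv_ii1 := commutes_of_weight_invariant mphi1 mw1 ac1 mk1 k10 k1E mh kh1 Psa PP
  (fun F G => (UB F G).1) Um1 (fun F H => (Uker0 F H).1) (fun F G H => (UC F G H).1).
have inv_ii2 := commutes_of_weight_invariant mphi2 mw2 ac2 mk2 k20 k2E mh kh2 Psa PP
  (fun F G => (UB F G).2) Um2 (fun F H => (Uker0 F H).2) (fun F G H => (UC F G H).2).
split.
  move=> meanE.
  have commU F G : P (F, G) -> P (U1 F, U1 G) /\ P (U2 F, U2 G).
    move=> FG.
    have [/= M1 M2] : opcolumn (mean_component lambda U1 P)
        (mean_component lambda U2 P) (F, (U1 G, U2 G)).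
      by rewrite meanE; exact: UC.
    split.
    - exact: (mean_component_commutes Pop lambda1 FG M1).
    - exact: (mean_component_commutes Pop lambda1 FG M2).
  split => -[F G] [V [/= PFV GE]].
  - exists (U1 F); split => //=; rewrite (GE : G = U1 V).
    by have [] := commU _ _ PFV.
  - exists (U2 F); split => //=; rewrite (GE : G = U2 V).
    by have [] := commU _ _ PFV.
split.
  move=> [sub1 sub2]; rewrite PP; split.
  - exact: (wco_commutes_mulop mphi1 mw1 ac1 mk1 k10 k1E mh kh1 (ii_inv.1 sub1)).
  - exact: (wco_commutes_mulop mphi2 mw2 ac2 mk2 k20 k2E mh kh2 (ii_inv.2 sub2)).
split; first by rewrite PP AE.
rewrite AE => -[sub1 sub2].
have [inv1 inv2] : weight_invariant mu phi1 w1 h /\ weight_invariant mu phi2 w2 h.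
  split.
  - apply: (weight_invariant_test mphi1 mw1 ac1 mk1 k10 k1E mh kh1).
    move=> n E K L M _ EK EL KM.
    have /sub1[L' [/= EL' LM']] : opcomp C1 (mulop h) (E, M) by exists K.
    by rewrite (wco_fun EL EL').
  - apply: (weight_invariant_test mphi2 mw2 ac2 mk2 k20 k2E mh kh2).
    move=> n E K L M _ EK EL KM.
    have /sub2[L' [/= EL' LM']] : opcomp C2 (mulop h) (E, M) by exists K.
    by rewrite (wco_fun EL EL').
rewrite (commutes_mean_component Pop _ (inv_ii1 inv1)).
rewrite (commutes_mean_component Pop _ (inv_ii2 inv2)).
rewrite TE; apply/seteqP; split => -[F [G1 G2]] /=.
  move=> [[V [/= PV G1E]] [V' [/= PV' G2E]]]; exists V; split => //=.
  by rewrite /graph_of /= (G1E : G1 = U1 V) (operator_inj Pop PV PV')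
    (G2E : G2 = U2 V').
move=> [V [/= PV GE]]; have [G1E G2E] : (G1, G2) = (U1 V, U2 V) := GE.
by split; exists V.
Qed.
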